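(* Let $\mathbb K\in\{\mathbb R,\mathbb C\}$, let $X\subseteq\mathbb K^n$ be a closed analytic set with $0\in X$, let $u\in T_0X\setminus\{0\}$, and let $f:\mathbb K^n\to\mathbb R$ be a $C^2$ function. Assume that one of the following hypotheses is satisfied: (1) $X$ is a smooth analytic submanifold near $0$; (2) $X$ is a (germ of a) homogeneous analytic cone; (3) $X$ is an analytic hypersurface near $0$, locally defined by $g=0$, and $\nabla g^{[*]}(u)\neq0$; (4) $X$ is a germ at $0$ of an analytic complete intersection which is nondegenerate along the direction $u$. Then: (i) The second-order necessary condition for $0$ to be a local minimizer of $f$ on $X$ (namely: if $0$ is a local minimizer of $f$ on $X$, then $\inf_{w\in T^2_{0,u}X}\bigl(\langle u,\nabla^2f(0)u\rangle+\langle\nabla f(0),w\rangle\bigr)\ge0$ for every $u\in T_0X\setminus\{0\}$ satisfying $\langle\nabla f(0),u\rangle=0$) can be written algebraically as $$\inf_{w\in T^{2,a}_{0,u}X}\Bigl(\langle u,\nabla^2f(0)u\rangle+\langle\nabla f(0),w\rangle\Bigr)\ge0$$ for every $u\in T_0X\setminus\{0\}$ satisfying $\langle\nabla f(0),u\rangle=0$. (ii) If, in addition, the parabolic regularity hypothesis (defined in the context) is satisfied, then the second-order sufficient condition (stated in the context) can also be checked algebraically by replacing $T^2_{0,u}X$ with $T^{2,a}_{0,u}X$; that is, its condition (b) may be replaced by: for every $u\in T_0X\setminus\{0\}$ with $\langle\nabla f(0),u\rangle=0$, $$\inf_{w\in T^{2,a}_{0,u}X}\Bigl(\langle u,\nabla^2f(0)u\rangle+\langle\nabla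 f(0),w\rangle\Bigr)>0.$$
   Context: An analytic function is one that is locally given by convergent power series (real-analytic for $\mathbb K=\mathbb R$, holomorphic for $\mathbb K=\mathbb C$). An analytic set $X$ in an open set $U\subseteq\mathbb K^n$ is a subset of $U$ such that every $a\in U$ has a neighborhood $V\subseteq U$ on which $X\cap V$ is the common zero set of finitely many analytic functions $V\to\mathbb K$. $\mathcal I(X,0)$ is the ideal of germs at $0$ of analytic functions on $\mathbb K^n$ that vanish on $X\cap V$ for some neighborhood $V$ of $0$. $T_0X$ is the set of $v\in\mathbb K^n$ for which there are $x_k\in X\setminus\{0\}$ and real $t_k>0$ with $x_k\to0$ and $t_kx_k\to v$. For a nonzero germ $g=g_m+g_{m+1}+\cdots$ (power series expansion at $0$ into homogeneous polynomials $g_j$ of degree $j$, with $g_m\not\equiv0$), $g^{[*]}:=g_m$ is the initial form and $g^{[*]+1}:=g_{m+1}$ (possibly zero). $T^2_{0,u}X$ is the set of all $w\in\mathbb K^n$ for which there are positive real numbers $t_k\downarrow0$ and $w_k\in\mathbb K^n$ with $w_k\to w$ such that $t_ku+\frac12t_k^2w_k\in X$ for every $k$. $T^{2,a}_{0,u}X:=\{w\in\mathbb K^n:\ \tfrac12\langle\nabla g^{[*]}(u),w\rangle+g^{[*]+1}(u)=0\ \text{ for all nonzero } g\in\mathcal I(X,0)\}$, where in this formula $\nabla$ is the vector of partial derivatives over $\mathbb K$ and $\langle a,b\rangle=\sum_i a_ib_i$. Smooth analytic submanifold near $0$: there is a neighborhood $U$ of $0$ such that $X\cap U$ is an analytic submanifold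 of $\mathbb K^n$. Homogeneous analytic cone: an analytic set defined near $0$ by homogeneous analytic equations, equivalently its defining ideal is generated by homogeneous analytic functions. Analytic hypersurface near $0$, locally defined by $g=0$: $X=\{x: g(x)=0\}$ near $0$ for an analytic function $g$. Analytic complete intersection at $0$: $\mathcal I(X,0)=\langle g_1,\dots,g_p\rangle$ is generated by exactly $p=n-\dim_0X$ analytic function germs and $X=\{g_1=\cdots=g_p=0\}$ near $0$. It is nondegenerate along $u$ if the $p\times n$ matrix with rows $\nabla g_i^{[*]}(u)$ has rank $p$. Second-order sufficient condition: assume (a) $\langle\nabla f(0),u\rangle\ge0$ for all $u\in T_0X$; (b) for every $u\in T_0X\setminus\{0\}$ with $\langle\nabla f(0),u\rangle=0$, $\inf_{w\in T^2_{0,u}X}\bigl(\langle u,\nabla^2f(0)u\rangle+\langle\nabla f(0),w\rangle\bigr)>0$; (c) the parabolic regularity hypothesis. Then $0$ is a strict local minimizer of $f$ on $X$, and there exist $c>0$, $\varepsilon>0$ with $f(x)\ge f(0)+c\|x\|^2$ for all $x\in X\cap B_\varepsilon(0)$. Parabolic regularity hypothesis (at $0$): for every sequence $\{x_k\}\subset X\setminus\{0\}$ with $x_k\to0$ and $\frac{f(x_k)-f(0)}{\|x_k\|^2}$ bounded above, there exist, after passing to a subsequence, a nonzero vector $u\in T_0X$, positive numbers $t_k\downarrow0$ and a bounded sequence $\{w_k\}\subseteq\mathbb K^n$ such that $x_k=t_ku+\frac12t_k^2w_k+o(t_k^2)$ and every cluster point of $\{w_k\}$ belongs to $T^2_{0,u}X$.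 For the objective $f$, $\nabla f(0)$ and $\nabla^2f(0)$ are the gradient and Hessian at $0$; when $\mathbb K=\mathbb C$, $\mathbb K^n$ is identified with $\mathbb R^{2n}$ and the gradient, Hessian and the pairings with them are the real Euclidean ones. $\|\cdot\|$ is the Euclidean norm, $B_\varepsilon(0)$ the ball of radius $\varepsilon$ about $0$. The infimum over the empty set is $+\infty$.
   Formalization: One of (1)–(4) is assumed at each critical direction u tested: at that u in (i), at every critical u in (ii). Assuming (3) at one fixed u only, (i) fails: X={z(y²−z³)=0}, f=z, with (3) holding at e2 but the infimum −∞ at e1. *)

(* Defs.v *)
From HB Require Import structures.
From mathcomp Require Import all_boot all_order all_algebra.
From mathcomp Require Import all_classical all_reals all_analysis.
From mathcomp Require Import complex.
(* the notations of mpoly clash with those of mathcomp-analysis *)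
From mathcomp Require Import (canonicals, coercions) mpoly.

Set Implicit Arguments.
Unset Strict Implicit.
Unset Printing Implicit Defensive.

Import Order.TTheory GRing.Theory Num.Theory numFieldNormedType.Exports.

Local Open Scope classical_set_scope.
Local Open Scope ring_scope.

(* The geometric notions are stated over a numFieldType K, to be used with
   K = R and K = R[i] only.  In the order of R[i], 0 < z (resp. z <= z') means
   that z (resp. z' - z) is a real number that is > 0 (resp. >= 0), so that
   "real t > 0" is rendered by (0 < t) in K; norms are K-valued.
   The norm of 'rV[K]_n is the sup norm; it is used for the topology only. *)

(* p.@[x] and the vector of formal partial derivatives of p at x *)
Definition peval (K : numFieldType) (n : nat) (p : mpoly.mpoly n K)
    (x : 'rV[K]_n) : K :=
  mpoly.meval (fun i => x 0 i) p.

Definition pgrad (K : numFieldType) (n : nat) (p : mpoly.mpoly n K)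
    (x : 'rV[K]_n) : 'rV[K]_n :=
  \row_i peval (mpoly.mderiv i p) x.

Definition pairing (K : numFieldType) (n : nat) (a b : 'rV[K]_n) : K :=
  \sum_i a 0 i * b 0 i.

(* [power_series_at g a p]: near a, g is the sum of the power series whose
   homogeneous part of degree j is p j.  The multivariate series of monomials
   is required to converge absolutely on a polydisc of polyradius (r, .., r). *)
Definition power_series_at (K : numFieldType) (n : nat) (g : 'rV[K]_n -> K)
    (a : 'rV[K]_n) (p : nat -> mpoly.mpoly n K) : Prop :=
  (forall j, p j \is mpoly.ishomog1 j mpoly.mdeg) /\
  exists r : K,
    [/\ 0 < r,
        exists M : K, forall N : nat,
          \sum_(j < N) \sum_(m <- mpoly.msupp (p j))
             `|mpoly.mcoeff m (p j)| * r ^+ j <= M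
      & forall y : 'rV[K]_n, `|y| < r ->
          (fun N : nat => \sum_(j < N) peval (p j) y) @ \oo --> g (a + y)].

Definition analytic_at (K : numFieldType) (n : nat) (g : 'rV[K]_n -> K)
    (a : 'rV[K]_n) : Prop :=
  exists p, power_series_at g a p.

Definition analytic_on (K : numFieldType) (n : nat) (V : set 'rV[K]_n)
    (g : 'rV[K]_n -> K) : Prop :=
  forall a, V a -> analytic_at g a.

(* Germs at 0 are represented by total functions, considered near 0 only. *)
Definition analytic_germ (K : numFieldType) (n : nat) (g : 'rV[K]_n -> K)
    : Prop :=
  \forall a \near (0 : 'rV[K]_n), analytic_at g a.

Definition analytic_set (K : numFieldType) (n : nat) (U X : set 'rV[K]_n)
    : Prop :=
  [/\ open U, X `<=` U
    & forall a, U a -> exists V : set 'rV[K]_n,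
        [/\ open V, V a, V `<=` U
          & exists (q : nat) (g : 'I_q -> 'rV[K]_n -> K),
              (forall i, analytic_on V (g i)) /\
              (forall x, V x -> (X x <-> forall i, g i x = 0))]].

(* membership in the ideal I(X,0) *)
Definition vanishing_germ (K : numFieldType) (n : nat) (X : set 'rV[K]_n)
    (g : 'rV[K]_n -> K) : Prop :=
  analytic_germ g /\ \forall x \near (0 : 'rV[K]_n), X x -> g x = 0.

(* [initial_degree g p m]: g is a nonzero germ with expansion p at 0 and
   order m; thus its initial form g^[*] is p m and g^[*]+1 is p m.+1. *)
Definition initial_degree (K : numFieldType) (n : nat) (g : 'rV[K]_n -> K)
    (p : nat -> mpoly.mpoly n K) (m : nat) : Prop :=
  [/\ power_series_at g 0 p, p m != 0 & forall j, (j < m)%N -> p j = 0].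

Definition tangent_cone (K : numFieldType) (n : nat) (X : set 'rV[K]_n)
    : set 'rV[K]_n :=
  [set v | exists (x : nat -> 'rV[K]_n) (t : nat -> K),
     [/\ forall k, X (x k) /\ x k != 0,
         forall k, 0 < t k,
         x k @[k --> \oo] --> (0 : 'rV[K]_n)
       & (t k *: x k) @[k --> \oo] --> v]].

Definition decreases_to_0 (K : numFieldType) (t : nat -> K) : Prop :=
  [/\ forall k, 0 < t k, forall k, t k.+1 <= t k
    & t k @[k --> \oo] --> (0 : K)].

(* T^2_{0,u} X *)
Definition tangent2 (K : numFieldType) (n : nat) (X : set 'rV[K]_n)
    (u : 'rV[K]_n) : set 'rV[K]_n :=
  [set w | exists (t : nat -> K) (w_ : nat -> 'rV[K]_n),
     [/\ decreases_to_0 t,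
         w_ k @[k --> \oo] --> w
       & forall k, X (t k *: u + (2^-1 * t k ^+ 2) *: w_ k)]].

(* T^{2,a}_{0,u} X *)
Definition tangent2_alg (K : numFieldType) (n : nat) (X : set 'rV[K]_n)
    (u : 'rV[K]_n) : set 'rV[K]_n :=
  [set w | forall g p m, vanishing_germ X g -> initial_degree g p m ->
     2^-1 * pairing (pgrad (p m) u) w + peval (p m.+1) u = 0].

(* M is a d-dimensional analytic submanifold of K^n: around each of its points
   there is an analytic chart phi : V -> W, with analytic inverse psi, that
   maps M to the coordinate subspace K^d x 0. *)
Definition submanifold (K : numFieldType) (n d : nat) (M : set 'rV[K]_n)
    : Prop :=
  (d <= n)%N /\
  forall a, M a ->
    exists (V W : set 'rV[K]_n) (phi psi : 'rV[K]_n -> 'rV[K]_n),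
      [/\ open V /\ open W,
          V a,
          forall x, V x -> W (phi x) /\ psi (phi x) = x,
          forall y, W y -> V (psi y) /\ phi (psi y) = y
        & [/\ forall i, analytic_on V (fun x => phi x 0 i),
              forall i, analytic_on W (fun y => psi y 0 i)
            & forall x, V x ->
                (M x <-> forall i : 'I_n, (d <= i)%N -> phi x 0 i = 0)]].

(* dim_0 X: the largest d such that X contains d-dimensional analytic
   submanifolds in every neighborhood of 0. *)
Definition contains_dim (K : numFieldType) (n : nat) (X : set 'rV[K]_n)
    (d : nat) : Prop :=
  forall V, nbhs (0 : 'rV[K]_n) V ->
    exists M : set 'rV[K]_n, [/\ M `<=` X `&` V, M !=set0 & submanifold d M].

Definition local_dim (K : numFieldType) (n : nat) (X : set 'rV[K]_n)
    (d : nat) : Prop :=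
  contains_dim X d /\ forall e, contains_dim X e -> (e <= d)%N.

Definition smooth_at0 (K : numFieldType) (n : nat) (X : set 'rV[K]_n) : Prop :=
  exists (U : set 'rV[K]_n) (d : nat),
    [/\ open U, U 0 & submanifold d (X `&` U)].

Definition homogeneous (K : numFieldType) (n d : nat) (h : 'rV[K]_n -> K)
    : Prop :=
  forall (c : K) x, h (c *: x) = c ^+ d * h x.

Definition homogeneous_cone (K : numFieldType) (n : nat) (X : set 'rV[K]_n)
    : Prop :=
  exists (q : nat) (h : 'I_q -> 'rV[K]_n -> K),
    (forall i, analytic_germ (h i) /\ exists d, homogeneous d (h i)) /\
    \forall x \near (0 : 'rV[K]_n), X x <-> forall i, h i x = 0.

Definition nondegenerate_hypersurface (K : numFieldType) (n : nat)
    (X : set 'rV[K]_n) (u : 'rV[K]_n) : Prop :=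
  exists g p m,
    [/\ analytic_germ g,
        \forall x \near (0 : 'rV[K]_n), X x <-> g x = 0,
        initial_degree g p m
      & pgrad (p m) u != 0].

(* I(X,0) = <g_0, .., g_(q-1)> *)
Definition generates_ideal (K : numFieldType) (n : nat) (X : set 'rV[K]_n)
    (q : nat) (g : 'I_q -> 'rV[K]_n -> K) : Prop :=
  (forall i, vanishing_germ X (g i)) /\
  forall h, vanishing_germ X h ->
    exists a : 'I_q -> 'rV[K]_n -> K,
      (forall i, analytic_germ (a i)) /\
      \forall x \near (0 : 'rV[K]_n), h x = \sum_i a i x * g i x.

Definition nondegenerate_complete_intersection (K : numFieldType) (n : nat)
    (X : set 'rV[K]_n) (u : 'rV[K]_n) : Prop :=
  exists (q d : nat) (g : 'I_q -> 'rV[K]_n -> K)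
         (p : 'I_q -> nat -> mpoly.mpoly n K) (m : 'I_q -> nat),
    [/\ local_dim X d /\ (q + d = n)%N,
        generates_ideal X g,
        \forall x \near (0 : 'rV[K]_n), X x <-> forall i, g i x = 0,
        forall i, initial_degree (g i) (p i) (m i)
      & \rank (\matrix_(i < q) pgrad (p i (m i)) u) = q].

Definition admissible (K : numFieldType) (n : nat) (X : set 'rV[K]_n)
    (u : 'rV[K]_n) : Prop :=
  [\/ smooth_at0 X, homogeneous_cone X, nondegenerate_hypersurface X u
    | nondegenerate_complete_intersection X u].

Definition C1 (R : realType) (N : nat) (F : 'rV[R]_N -> R) : Prop :=
  (forall (i : 'I_N) x, derivable F x (delta_mx 0 i)) /\
  (forall i : 'I_N, continuous ('D_(delta_mx 0 i) F)).

Definition C2 (R : realType) (N : nat) (F : 'rV[R]_N -> R) : Prop :=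
  C1 F /\ forall i : 'I_N, C1 ('D_(delta_mx 0 i) F).

Definition gradient (R : realType) (N : nat) (F : 'rV[R]_N -> R)
    (x : 'rV[R]_N) : 'rV[R]_N :=
  \row_i 'D_(delta_mx 0 i) F x.

Definition hessian (R : realType) (N : nat) (F : 'rV[R]_N -> R)
    (x : 'rV[R]_N) : 'M[R]_N :=
  \matrix_(i, j) 'D_(delta_mx 0 i) ('D_(delta_mx 0 j) F) x.

Inductive scalar_kind := RealScalars | ComplexScalars.

Definition scalars (R : realType) (s : scalar_kind) : numFieldType :=
  match s with RealScalars => R | ComplexScalars => R[i] end.

(* the identification of K^n with R^n or R^(2n) = R^n x R^n *)
Definition real_dim (s : scalar_kind) (n : nat) : nat :=
  match s with RealScalars => n | ComplexScalars => (n + n)%N end.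

Definition to_real (R : realType) (s : scalar_kind) (n : nat) :
    'rV[scalars R s]_n -> 'rV[R]_(real_dim s n) :=
  match s return 'rV[scalars R s]_n -> 'rV[R]_(real_dim s n) with
  | RealScalars => fun x => x
  | ComplexScalars => fun z : 'rV[R[i]]_n =>
      row_mx (map_mx (@complex.Re R) z) (map_mx (@complex.Im R) z)
  end.

Definition of_real (R : realType) (s : scalar_kind) (n : nat) :
    'rV[R]_(real_dim s n) -> 'rV[scalars R s]_n :=
  match s return 'rV[R]_(real_dim s n) -> 'rV[scalars R s]_n with
  | RealScalars => fun x => x
  | ComplexScalars => fun x : 'rV[R]_(n + n) =>
      \row_j complex.Complex (lsubmx x 0 j) (rsubmx x 0 j)
  end.

Definition C2_objective (R : realType) (s : scalar_kind) (n : nat)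
    (f : 'rV[scalars R s]_n -> R) : Prop :=
  C2 (f \o @of_real R s n).

(* < grad f(0), v > and < u, Hess f(0) u >, real Euclidean pairings *)
Definition slope (R : realType) (s : scalar_kind) (n : nat)
    (f : 'rV[scalars R s]_n -> R) (v : 'rV[scalars R s]_n) : R :=
  pairing (gradient (f \o @of_real R s n) 0) (to_real v).

Definition curvature (R : realType) (s : scalar_kind) (n : nat)
    (f : 'rV[scalars R s]_n -> R) (u : 'rV[scalars R s]_n) : R :=
  pairing (to_real u) (to_real u *m (hessian (f \o @of_real R s n) 0)^T).

(* inf over w in S of < u, Hess f(0) u > + < grad f(0), w >; it is +oo when S
   is empty *)
Definition second_order_inf (R : realType) (s : scalar_kind) (n : nat)
    (f : 'rV[scalars R s]_n -> R) (u : 'rV[scalars R s]_n)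
    (S : set 'rV[scalars R s]_n) : \bar R :=
  ereal_inf [set (curvature f u + slope f w)%:E | w in S].

Definition enorm (R : realType) (s : scalar_kind) (n : nat)
    (x : 'rV[scalars R s]_n) : R :=
  Num.sqrt (\sum_i to_real x 0 i ^+ 2).

Definition local_minimizer0 (R : realType) (s : scalar_kind) (n : nat)
    (X : set 'rV[scalars R s]_n) (f : 'rV[scalars R s]_n -> R) : Prop :=
  \forall x \near (0 : 'rV[scalars R s]_n), X x -> f 0 <= f x.

Definition strict_local_minimizer0 (R : realType) (s : scalar_kind) (n : nat)
    (X : set 'rV[scalars R s]_n) (f : 'rV[scalars R s]_n -> R) : Prop :=
  \forall x \near (0 : 'rV[scalars R s]_n), X x -> x != 0 -> f 0 < f x.

Definition quadratic_growth0 (R : realType) (s : scalar_kind) (n : nat)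
    (X : set 'rV[scalars R s]_n) (f : 'rV[scalars R s]_n -> R) : Prop :=
  exists c e : R, [/\ 0 < c, 0 < e
    & forall x, X x -> enorm x < e -> f 0 + c * enorm x ^+ 2 <= f x].

Definition parabolic_regularity (R : realType) (s : scalar_kind) (n : nat)
    (X : set 'rV[scalars R s]_n) (f : 'rV[scalars R s]_n -> R) : Prop :=
  forall x : nat -> 'rV[scalars R s]_n,
    (forall k, X (x k) /\ x k != 0) ->
    x k @[k --> \oo] --> (0 : 'rV[scalars R s]_n) ->
    (exists M : R, forall k, (f (x k) - f 0) / enorm (x k) ^+ 2 <= M) ->
    exists (sub : nat -> nat) (u : 'rV[scalars R s]_n)
           (t : nat -> scalars R s) (w : nat -> 'rV[scalars R s]_n),
      [/\ {homo sub : i j / (i < j)%N},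
          tangent_cone X u /\ u != 0,
          decreases_to_0 t,
          exists M : scalars R s, forall k, `|w k| <= M
        & ((t k ^+ 2)^-1 *:
             (x (sub k) - (t k *: u + (2^-1 * t k ^+ 2) *: w k)))
             @[k --> \oo] --> (0 : 'rV[scalars R s]_n) /\
          cluster (w k @[k --> \oo]) `<=` tangent2 X u].

(* directions u in T_0 X \ {0} with < grad f(0), u > = 0 *)
Definition critical (R : realType) (s : scalar_kind) (n : nat)
    (X : set 'rV[scalars R s]_n) (f : 'rV[scalars R s]_n -> R)
    (u : 'rV[scalars R s]_n) : Prop :=
  [/\ tangent_cone X u, u != 0 & slope f u = 0].

(* Main.v *)
From HB Require Import structures.
Require Import Defs.
From mathcomp Require Import all_boot all_order all_algebra.
From mathcomp Require Import all_classical all_reals all_analysis.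
From mathcomp Require Import complex ring lra.
From mathcomp Require Import (canonicals, coercions) mpoly.

Set Implicit Arguments.
Unset Strict Implicit.
Unset Printing Implicit Defensive.

Import Order.TTheory GRing.Theory Num.Theory numFieldNormedType.Exports.

Local Open Scope classical_set_scope.
Local Open Scope ring_scope.

(* Rescaling a germ g of order m along t u + t^2/2 w gives
     t^-(m+1) g(t u + t^2/2 w) -> 1/2 <grad g_m(u), w> + g_{m+1}(u)   as t -> 0+,
   provided g_m(u) = 0, with an error that is O(t) and O(t)-Lipschitz in w; this yields
   T^2 <= T^{2,a} for every X.  Conversely, if the gradients of the initial forms are independent,
   a contraction argument perturbs each w in T^{2,a} by O(t) to an exact zero (hypersurfaces and
   complete intersections); if X is smooth, zeroing the transverse coordinates in a chart moves
   t u + t^2/2 w by O(t^3) onto X.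
   For a homogeneous cone, T^{2,a} can be strictly larger than T^2 (X = {xy = 0} in K^3 along the
   z-axis).  But there 0 is in T^2, and since X = -X the slope, being nonnegative on T_0 X,
   vanishes on X; as every linear form vanishing on X belongs to I(X,0), it vanishes on T^{2,a}
   too, so both infima equal the curvature term. *)

(** Since T^{2,a} may exceed T^2 for cones, the two sets are compared only through f: each w in
    T^{2,a} gets some w' in T^2 with the same slope, which is enough because the curvature term does
    not depend on w. The price is that the slope must be nonnegative on T_0 X; minimality gives this
    in (i), condition (a) in (ii). Over C the objective is only real differentiable, whereas I(X,0)
    consists of holomorphic germs. The link is that the slope is the real part of a C-linear form
    and that a cone is stable under complex scalars: a slope vanishing on the cone makes the whole
    complex form vanish there. The contraction is the reason why polynomials and series are
    estimated through differences at two moving points: after rescaling, the equations read v =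
    E(v), where E has Lipschitz constant O(t) on a fixed ball and E(0) = O(t), hence a fixed point
    of size O(t). *)

Lemma coord_le_mx_norm (K : numDomainType) m n (x : 'M[K]_(m, n)) i j :
  `|x i j| <= mx_norm x.
Proof.
rewrite mx_normE -[leLHS]nngE num_le.
exact: (le_bigmax _ (fun ij => `|x ij.1 ij.2|%:nng) (i, j)).
Qed.

(* The library norm over K is K-valued; estimates are carried out in R through rabs and rnorm. *)
Definition rcst (R : realType) (s : scalar_kind) : R -> scalars R s :=
  match s with RealScalars => id | ComplexScalars => real_complex R end.

Definition rabs (R : realType) (s : scalar_kind) : scalars R s -> R :=
  match s with RealScalars => fun x : R => `|x| | ComplexScalars => @Normc.normc R end.

Definition rnorm (R : realType) (s : scalar_kind) n (x : 'rV[scalars R s]_n) : R :=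
  rabs `|x|.

Arguments rcst {R} s x.

(** * Real-valued norms over R and R[i] *)

Section Norms.
Variables (R : realType) (s : scalar_kind).
Notation K := (scalars R s).
Implicit Types (z : K) (x y : R).

Lemma norm_rabs z : `|z| = rcst s (rabs z).
Proof. by case: s z. Qed.

Lemma rcst0 : rcst s 0 = 0 :> K. Proof. by case: s. Qed.
Lemma rcst1 : rcst s 1 = 1 :> K. Proof. by case: s. Qed.
Lemma rcstD x y : rcst s (x + y) = rcst s x + rcst s y.
Proof. by case: s => //=; rewrite rmorphD. Qed.
Lemma rcstN x : rcst s (- x) = - rcst s x.
Proof. by case: s => //=; rewrite rmorphN. Qed.
Lemma rcstM x y : rcst s (x * y) = rcst s x * rcst s y.
Proof. by case: s => //=; rewrite rmorphM. Qed.
Lemma rcstV x : rcst s x^-1 = (rcst s x)^-1.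
Proof. by case: s => //=; rewrite fmorphV. Qed.
Lemma rcstX x n : rcst s (x ^+ n) = rcst s x ^+ n.
Proof. by elim: n => [|n IH]; rewrite ?expr0 ?rcst1 // !exprS rcstM IH. Qed.
Lemma rcst_nat n : rcst s (n%:R : R) = n%:R.
Proof. by elim: n => [|n IH]; rewrite ?rcst0 // -addn1 !natrD rcstD IH rcst1. Qed.
Lemma rcst_le x y : (rcst s x <= rcst s y) = (x <= y).
Proof. by case: s => //=; rewrite lecR. Qed.
Lemma rcst_lt x y : (rcst s x < rcst s y) = (x < y).
Proof. by case: s => //=; rewrite ltcR. Qed.
Lemma rcst_inj : injective (@rcst R s).
Proof. by case: s => //= x y; exact: complexI. Qed.
Lemma rcst_eq0 x : (rcst s x == 0) = (x == 0).
Proof. by rewrite -rcst0 (inj_eq rcst_inj). Qed.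

Lemma rabs_ge0 z : 0 <= rabs z.
Proof. by rewrite -rcst_le -norm_rabs rcst0. Qed.
Lemma rabs_rcst x : rabs (rcst s x) = `|x|.
Proof.
apply: rcst_inj; rewrite -norm_rabs; case: s => //=.
by rewrite normc_def /= expr0n addr0 sqrtr_sqr.
Qed.
Lemma gt0_rcst z : 0 < z -> exists2 x, 0 < x & z = rcst s x.
Proof.
move=> z0; exists (rabs z); last by rewrite -norm_rabs gtr0_norm.
by rewrite -rcst_lt -norm_rabs gtr0_norm // rcst0.
Qed.
Lemma rabs0 : rabs (0 : K) = 0. Proof. by rewrite -rcst0 rabs_rcst normr0. Qed.
Lemma rabs1 : rabs (1 : K) = 1. Proof. by rewrite -rcst1 rabs_rcst normr1. Qed.
Lemma rabsM z z' : rabs (z * z') = rabs z * rabs z'.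
Proof. by apply: rcst_inj; rewrite rcstM -!norm_rabs normrM. Qed.
Lemma rabsX z n : rabs (z ^+ n) = rabs z ^+ n.
Proof. by apply: rcst_inj; rewrite rcstX -!norm_rabs normrX. Qed.
Lemma rabsN z : rabs (- z) = rabs z.
Proof. by apply: rcst_inj; rewrite -!norm_rabs normrN. Qed.
Lemma rabsV z : rabs z^-1 = (rabs z)^-1.
Proof. by apply: rcst_inj; rewrite rcstV -!norm_rabs normfV. Qed.
Lemma rabsD z z' : rabs (z + z') <= rabs z + rabs z'.
Proof. by rewrite -rcst_le rcstD -!norm_rabs ler_normD. Qed.
Lemma rabsB z z' : rabs (z - z') = rabs (z' - z).
Proof. by rewrite -rabsN opprB. Qed.
Lemma rabs_eq0 z : (rabs z == 0) = (z == 0).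
Proof. by rewrite -rcst_eq0 -norm_rabs normr_eq0. Qed.
Lemma rabs_sum I (r : seq I) (P : pred I) (F : I -> K) :
  rabs (\sum_(i <- r | P i) F i) <= \sum_(i <- r | P i) rabs (F i).
Proof.
elim/big_ind2 : _ => [|a b c d ab cd|//]; first by rewrite rabs0.
by rewrite (le_trans (rabsD _ _)) ?lerD.
Qed.
Lemma rcst_sum I (r : seq I) (P : pred I) (F : I -> R) :
  rcst s (\sum_(i <- r | P i) F i) = \sum_(i <- r | P i) rcst s (F i).
Proof. by apply: big_morph; [exact: rcstD|exact: rcst0]. Qed.

Section Vectors.
Variable n : nat.
Implicit Types u v : 'rV[K]_n.

Lemma norm_rnorm u : `|u| = rcst s (rnorm u).
Proof. by rewrite /rnorm -norm_rabs normr_id. Qed.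
Lemma rnorm_ge0 u : 0 <= rnorm u. Proof. exact: rabs_ge0. Qed.
Lemma rnorm0 : rnorm (0 : 'rV[K]_n) = 0. Proof. by rewrite /rnorm normr0 rabs0. Qed.
Lemma rnorm_eq0 u : (rnorm u == 0) = (u == 0).
Proof. by rewrite /rnorm rabs_eq0 normr_eq0. Qed.
Lemma rnorm_gt0 u : (0 < rnorm u) = (u != 0).
Proof. by rewrite lt0r rnorm_ge0 rnorm_eq0 andbT. Qed.
Lemma rnormD u v : rnorm (u + v) <= rnorm u + rnorm v.
Proof. by rewrite -rcst_le rcstD -!norm_rnorm ler_normD. Qed.
Lemma rnormB u v : rnorm (u - v) = rnorm (v - u).
Proof. by rewrite /rnorm distrC. Qed.
Lemma rnormZ z u : rnorm (z *: u) = rabs z * rnorm u.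
Proof. by apply: rcst_inj; rewrite rcstM -norm_rabs -!norm_rnorm normrZ. Qed.

Lemma rabs_coord u i : rabs (u 0 i) <= rnorm u.
Proof.
by rewrite -rcst_le -norm_rabs -norm_rnorm [leRHS]/Num.norm /= coord_le_mx_norm.
Qed.

Lemma rnorm_le u x : 0 <= x -> (forall i, rabs (u 0 i) <= x) -> rnorm u <= x.
Proof.
move=> x0 ux; rewrite -rcst_le -norm_rnorm [leLHS]/Num.norm /=.
case: (eqVneq (mx_norm u) 0) => [->|/mx_norm_neq0 [[i j] ->]] /=.
  by rewrite -rcst0 rcst_le.
by rewrite (ord1 i) norm_rabs rcst_le.
Qed.

Lemma nearE_rnorm u (P : set 'rV[K]_n) :
  (\forall v \near u, P v) <-> exists2 e : R, 0 < e & forall v, rnorm (v - u) < e -> P v.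
Proof.
split=> [/nbhs_ballP [e /= /gt0_rcst [x x0 ->]] eP|[e e0 eP]].
  exists x => // v vx; apply: eP; rewrite mx_norm_ball /ball_ /= norm_rnorm rcst_lt.
  by rewrite rnormB.
apply/nbhs_ballP; exists (rcst s e); first by rewrite /= -rcst0 rcst_lt.
move=> v; rewrite mx_norm_ball /ball_ /= norm_rnorm rcst_lt => ve.
by apply: eP; rewrite rnormB.
Qed.

(** Turns convergence in K^n into that of real numbers, where squeezing and comparison of limits are
    available. *)
Lemma cvg_rnorm T (F : set_system T) (FF : Filter F) (f : T -> 'rV[K]_n) u :
  (f x @[x --> F] --> u) <-> (rnorm (f x - u) @[x --> F] --> (0 : R)).
Proof.
split=> fu.
  apply/cvgr0Pnorm_lt => e e0.
  move/cvgrPdist_lt : fu => /(_ (rcst s e)); rewrite -rcst0 rcst_lt => /(_ e0).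
  apply: filterS => x; rewrite norm_rnorm rcst_lt rnormB.
  by rewrite ger0_norm ?rnorm_ge0.
apply/cvgrPdist_lt => _ /gt0_rcst [e e0 ->].
move/cvgr0Pnorm_lt : fu => /(_ e e0).
by apply: filterS => x; rewrite norm_rnorm rcst_lt rnormB ger0_norm ?rnorm_ge0.
Qed.
End Vectors.

Lemma cvg_rabs T (F : set_system T) (FF : Filter F) (f : T -> K) z :
  (f x @[x --> F] --> z) <-> (rabs (f x - z) @[x --> F] --> (0 : R)).
Proof.
split=> fu.
  apply/cvgr0Pnorm_lt => e e0.
  move/cvgrPdist_lt : fu => /(_ (rcst s e)); rewrite -rcst0 rcst_lt => /(_ e0).
  apply: filterS => x; rewrite norm_rabs rcst_lt rabsB.
  by rewrite ger0_norm ?rabs_ge0.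
apply/cvgrPdist_lt => _ /gt0_rcst [e e0 ->].
move/cvgr0Pnorm_lt : fu => /(_ e e0).
by apply: filterS => x; rewrite norm_rabs rcst_lt rabsB ger0_norm ?rabs_ge0.
Qed.

Lemma rabs_pairing n (a v : 'rV[K]_n) :
  rabs (pairing a v) <= n%:R * rnorm a * rnorm v.
Proof.
apply: le_trans (rabs_sum _ _ _) _.
rewrite -mulrA mulr_natl -[X in _ *+ X](card_ord n) -sumr_const.
apply: ler_sum => i _; rewrite rabsM ler_pM ?rabs_ge0 ?rabs_coord//.
Qed.

Lemma rnorm_mulmx q n (v : 'rV[K]_q) (M : 'M[K]_(q, n)) :
  rnorm (v *m M) <= (\sum_i \sum_j rabs (M i j)) * rnorm v.
Proof.
apply: rnorm_le => [|j].
  by rewrite mulr_ge0 ?rnorm_ge0 // sumr_ge0 // => i _; rewrite sumr_ge0 // => j _; exact: rabs_ge0.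
rewrite mxE; apply: le_trans (rabs_sum _ _ _) _; rewrite mulr_suml ler_sum // => i _.
rewrite rabsM mulrC ler_pM ?rabs_ge0 ?rabs_coord//.
by rewrite (bigD1 j) //= lerDl sumr_ge0 // => k _; exact: rabs_ge0.
Qed.
End Norms.

(** * Polynomials and power series *)

Section Polynomials.
Variables (R : realType) (s : scalar_kind) (n : nat).
Notation K := (scalars R s).
Notation poly := (mpoly.mpoly n K).
Implicit Types (p q : poly) (x y u : 'rV[K]_n).

Lemma pevalE p x :
  peval p x = \sum_(m <- mpoly.msupp p) mpoly.mcoeff m p * \prod_i x 0 i ^+ m i.
Proof. exact: mpoly.mevalE. Qed.

Lemma pevalD p q x : peval (p + q) x = peval p x + peval q x.
Proof. exact: mpoly.mevalD. Qed.

Lemma pevalM p q x : peval (p * q) x = peval p x * peval q x.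
Proof. exact: mpoly.mevalM. Qed.

Lemma pevalC c x : peval (mpoly.mpolyC n c) x = c :> K.
Proof. exact: mpoly.mevalC. Qed.

Lemma peval0 x : peval 0 x = 0 :> K.
Proof. exact: mpoly.meval0. Qed.

Lemma peval_homog j p (c : K) x : p \is mpoly.ishomog1 j mpoly.mdeg ->
  peval p (c *: x) = c ^+ j * peval p x.
Proof.
move=> /mpoly.dhomogP hp; rewrite !pevalE mulr_sumr !big_seq; apply: eq_bigr => m mp.
rewrite mulrCA; congr (_ * _).
under eq_bigr do rewrite mxE exprMn.
by rewrite big_split /= -expr_sum -mpoly.mdegE hp.
Qed.

Lemma pairingDr (a v w : 'rV[K]_n) : pairing a (v + w) = pairing a v + pairing a w.
Proof. by rewrite -big_split; apply: eq_bigr => i _; rewrite mxE mulrDr. Qed.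
Lemma pairingZr (a v : 'rV[K]_n) c : pairing a (c *: v) = c * pairing a v.
Proof. by rewrite /pairing mulr_sumr; apply: eq_bigr => i _; rewrite mxE mulrCA. Qed.
Lemma pairingBr (a v w : 'rV[K]_n) : pairing a (v - w) = pairing a v - pairing a w.
Proof. by rewrite pairingDr -scaleN1r pairingZr mulN1r. Qed.
Lemma pairingDl (a b v : 'rV[K]_n) : pairing (a + b) v = pairing a v + pairing b v.
Proof. by rewrite -big_split; apply: eq_bigr => i _; rewrite mxE mulrDl. Qed.
Lemma pairingZl (a v : 'rV[K]_n) c : pairing (c *: a) v = c * pairing a v.
Proof. by rewrite /pairing mulr_sumr; apply: eq_bigr => i _; rewrite mxE mulrA. Qed.

(** The l1 norm of the coefficients, the quantity that [power_series_at] requires to be summable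
    against r^j. *)
Definition pnorm p : R := \sum_(m <- mpoly.msupp p) rabs (mpoly.mcoeff m p).

Lemma pnorm_ge0 p : 0 <= pnorm p.
Proof. by apply: sumr_ge0 => m _; exact: rabs_ge0. Qed.

(** [d] acts as a logarithmic derivative: |a - b| <= (d / rho) r delta, where r bounds both values.
    In this relative form products multiply the [r] and add the [d], so a monomial of degree j ends
    with r = rho^j and d = j. Keeping [rho] on the left avoids a division. *)
Definition lip_pair (rho delta : R) (a b : K) (r d : R) :=
  [/\ 0 <= r, 0 <= d, rabs a <= r, rabs b <= r & rho * rabs (a - b) <= d * r * delta].

Lemma lip_pair1 rho delta : lip_pair rho delta 1 1 1 0.
Proof. by split; rewrite ?rabs1 // subrr rabs0 mulr0 !mul0r. Qed.

Lemma lip_pairM rho delta a b r d a' b' r' d' : 0 <= rho ->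
  lip_pair rho delta a b r d -> lip_pair rho delta a' b' r' d' ->
  lip_pair rho delta (a * a') (b * b') (r * r') (d + d').
Proof.
move=> rho0 [r0 d0 ar br ab] [r'0 d'0 ar' br' ab']; split.
- exact: mulr_ge0.
- exact: addr_ge0.
- by rewrite rabsM ler_pM ?rabs_ge0.
- by rewrite rabsM ler_pM ?rabs_ge0.
have -> : a * a' - b * b' = (a - b) * a' + b * (a' - b') by ring.
apply: (@le_trans _ _ (rho * rabs (a - b) * rabs a' + rabs b * (rho * rabs (a' - b')))).
  rewrite -mulrA (mulrCA (rabs b)) -mulrDr ler_wpM2l // -!rabsM; exact: rabsD.
have -> : (d + d') * (r * r') * delta = d * r * delta * r' + r * (d' * r' * delta) by ring.
rewrite lerD // ler_pM ?rabs_ge0 ?mulr_ge0 ?rabs_ge0 //.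
Qed.

Lemma lip_pairX rho delta a b r d k : 0 <= rho -> lip_pair rho delta a b r d ->
  lip_pair rho delta (a ^+ k) (b ^+ k) (r ^+ k) (d *+ k).
Proof.
move=> rho0 ab; elim: k => [|k IH]; first by rewrite !expr0; exact: lip_pair1.
by rewrite !exprS mulrS; exact: lip_pairM.
Qed.

Lemma monomial_lipschitz (rho : R) (m : mpoly.multinom n) x y : 0 <= rho ->
  rnorm x <= rho -> rnorm y <= rho ->
  rho * rabs (\prod_i x 0 i ^+ m i - \prod_i y 0 i ^+ m i)
    <= (mpoly.mdeg m)%:R * rho ^+ mpoly.mdeg m * rnorm (x - y).
Proof.
move=> rho0 xr yr.
suff /(_ (index_enum 'I_n)) [] : forall l : seq 'I_n, lip_pair rho (rnorm (x - y))
    (\prod_(i <- l) x 0 i ^+ m i) (\prod_(i <- l) y 0 i ^+ m i)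
    (\prod_(i <- l) rho ^+ m i) (\sum_(i <- l) (m i)%:R).
  by rewrite -expr_sum -natr_sum -mpoly.mdegE.
elim=> [|i l IH]; first by rewrite !big_nil; exact: lip_pair1.
rewrite !big_cons; apply: lip_pairM => //.
rewrite -[(m i)%:R]/(1 *+ m i); apply: lip_pairX => //; split=> //.
- by rewrite (le_trans (rabs_coord _ _)).
- by rewrite (le_trans (rabs_coord _ _)).
- rewrite mul1r ler_wpM2l //.
  by have := rabs_coord (x - y) i; rewrite !mxE.
Qed.

Lemma homog_lipschitz j p (rho : R) x y : p \is mpoly.ishomog1 j mpoly.mdeg ->
  0 <= rho -> rnorm x <= rho -> rnorm y <= rho ->
  rho * rabs (peval p x - peval p y) <= pnorm p * (j%:R * rho ^+ j * rnorm (x - y)).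
Proof.
move=> /mpoly.dhomogP hp rho0 xr yr; rewrite !pevalE -sumrB.
apply: le_trans (ler_wpM2l rho0 (rabs_sum _ _ _)) _.
rewrite mulr_sumr mulr_suml !big_seq ler_sum // => m mp.
rewrite -mulrBr rabsM mulrCA ler_wpM2l ?rabs_ge0 // -(hp _ mp).
exact: monomial_lipschitz.
Qed.

(** Strict differentiability with a quadratic remainder. Both points move, since the blow-up has to
    be compared at two values of w; restricting to the unit ball about u makes the estimate stable
    under products. *)
Definition strict_diff (F : 'rV[K]_n -> K) u (a : 'rV[K]_n) :=
  exists2 C : R, 0 <= C & forall x y, rnorm (x - u) <= 1 -> rnorm (y - u) <= 1 ->
    rabs (F x - F y - pairing a (x - y))
      <= C * (rnorm (x - u) + rnorm (y - u)) * rnorm (x - y).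

Lemma strict_diff_lipschitz F u a : strict_diff F u a ->
  exists2 L : R, 0 <= L & forall x y, rnorm (x - u) <= 1 -> rnorm (y - u) <= 1 ->
    rabs (F x - F y) <= L * rnorm (x - y).
Proof.
move=> [C C0 CP]; exists (C * 2 + n%:R * rnorm a).
  by rewrite addr_ge0 ?mulr_ge0 ?rnorm_ge0.
move=> x y xu yu; rewrite -(subrK (pairing a (x - y)) (F x - F y)).
apply: le_trans (rabsD _ _) _; rewrite mulrDl lerD ?rabs_pairing //.
apply: le_trans (CP _ _ xu yu) _.
by rewrite ler_wpM2r ?rnorm_ge0 // ler_wpM2l // (natrD _ 1 1) lerD.
Qed.

Lemma strict_diff_cst c u : strict_diff (fun=> c) u 0.
Proof.
exists 0 => // x y _ _; rewrite !mul0r subrr sub0r rabsN /pairing big1 ?rabs0 // => i _.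
by rewrite mxE mul0r.
Qed.

Lemma strict_diff_coord i u : strict_diff (fun x => x 0 i) u (delta_mx 0 i).
Proof.
exists 0 => // x y _ _; rewrite !mul0r /pairing (bigD1 i) //= big1 => [|j /negbTE ji].
  by rewrite !mxE !eqxx mul1r addr0 subrr rabs0.
by rewrite !mxE ji andbF mul0r.
Qed.

Lemma strict_diffD F G u a b : strict_diff F u a -> strict_diff G u b ->
  strict_diff (fun x => F x + G x) u (a + b).
Proof.
move=> [C C0 CP] [D D0 DP]; exists (C + D); first exact: addr_ge0.
move=> x y xu yu; rewrite pairingDl.
have -> : F x + G x - (F y + G y) - (pairing a (x - y) + pairing b (x - y)) =
  (F x - F y - pairing a (x - y)) + (G x - G y - pairing b (x - y)) by ring.
by apply: le_trans (rabsD _ _) _; rewrite !mulrDl lerD ?CP ?DP // -mulrDl CP.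
Qed.

Lemma strict_diffM F G u a b : strict_diff F u a -> strict_diff G u b ->
  strict_diff (fun x => F x * G x) u (G u *: a + F u *: b).
Proof.
move=> sF sG.
have [L L0 LP] := strict_diff_lipschitz sF.
have [M M0 MP] := strict_diff_lipschitz sG.
case: sF sG => [C C0 CP] [D D0 DP].
have u1 : rnorm (u - u) <= 1 by rewrite subrr rnorm0.
set A := n%:R * rnorm a; set B := n%:R * rnorm b.
have A0 : 0 <= A by rewrite mulr_ge0 ?rnorm_ge0.
have B0 : 0 <= B by rewrite mulr_ge0 ?rnorm_ge0.
exists ((rabs (F u) + L) * D + (rabs (G u) + M) * C + L * B + M * A).
  by rewrite !addr_ge0 // mulr_ge0 // addr_ge0 ?rabs_ge0.
move=> x y xu yu; rewrite pairingDl !pairingZl.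
set h := x - y.
(* Product rule with two moving points: replacing the coefficients F x and G y by F u and G u costs
   multiples of |x - u| and |y - u|, times a linear form in h. *)
have -> : F x * G x - F y * G y - (G u * pairing a h + F u * pairing b h) =
  F x * (G x - G y - pairing b h) + G y * (F x - F y - pairing a h)
  + (F x - F u) * pairing b h + (G y - G u) * pairing a h by ring.
have Fx : rabs (F x) <= rabs (F u) + L.
  rewrite -(subrK (F u) (F x)) addrC (le_trans (rabsD _ _)) // lerD //.
  by rewrite (le_trans (LP _ _ xu u1)) // ler_piMr.
have Gy : rabs (G y) <= rabs (G u) + M.
  rewrite -(subrK (G u) (G y)) addrC (le_trans (rabsD _ _)) // lerD //.
  by rewrite (le_trans (MP _ _ yu u1)) // ler_piMr.
have h0 := rnorm_ge0 h; have x0 := rnorm_ge0 (x - u); have y0 := rnorm_ge0 (y - u).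
apply: le_trans (rabsD _ _) (le_trans (lerD (le_trans (rabsD _ _)
  (lerD (rabsD _ _) (lexx _))) (lexx _)) _).
have T1 := ler_pM (rabs_ge0 _) (rabs_ge0 _) Fx (DP _ _ xu yu).
have T2 := ler_pM (rabs_ge0 _) (rabs_ge0 _) Gy (CP _ _ xu yu).
have T3 := ler_pM (rabs_ge0 _) (rabs_ge0 _) (LP _ _ xu u1) (rabs_pairing b h).
have T4 := ler_pM (rabs_ge0 _) (rabs_ge0 _) (MP _ _ yu u1) (rabs_pairing a h).
rewrite -/A -/B -/h in T1 T2 T3 T4.
rewrite !rabsM.
apply: le_trans (lerD (lerD (lerD T1 T2) T3) T4) _.
set X := rnorm (x - u) in x0 *; set Y := rnorm (y - u) in y0 *; set H := rnorm h in h0 *.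
rewrite -subr_ge0.
set e := (X in 0 <= X).
have -> : e = L * B * Y * H + M * A * X * H by rewrite /e; ring.
by rewrite addr_ge0 ?mulr_ge0 ?rnorm_ge0.
Qed.

Lemma pgradD p q u : pgrad (p + q) u = pgrad p u + pgrad q u.
Proof. by apply/rowP => i; rewrite !mxE mpoly.mderivD pevalD. Qed.

Lemma pgradM p q u : pgrad (p * q) u = peval q u *: pgrad p u + peval p u *: pgrad q u.
Proof.
by apply/rowP => i; rewrite !mxE mpoly.mderivM pevalD !pevalM (mulrC (peval q u)).
Qed.

Lemma strict_diff_ext F G u a b : F =1 G -> a = b -> strict_diff F u a -> strict_diff G u b.
Proof. by move=> /funext <- <-. Qed.

Lemma pgradC c u : pgrad (mpoly.mpolyC n c) u = 0.
Proof. by apply/rowP => i; rewrite !mxE mpoly.mderivC peval0. Qed.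

Lemma pgradXU i u : pgrad (mpoly.mpolyX K (mpoly.mnm1 i)) u = delta_mx 0 i.
Proof.
apply/rowP => j; rewrite !mxE mpoly.mderivX mpoly.mnm1E eqxx /=.
have [<-|ij] := eqVneq i j; last by rewrite scale0r peval0.
by rewrite scale1r -{1}[mpoly.mnm1 i]mpoly.add0m mpoly.addmK mpoly.mpolyX0 -mpoly.mpolyC1 pevalC.
Qed.

Lemma pevalXU i u : peval (mpoly.mpolyX K (mpoly.mnm1 i)) u = u 0 i.
Proof. by rewrite /peval mpoly.mevalXU. Qed.

(** Constants and coordinates generate the polynomial ring, and the formal gradient obeys the same
    sum and product rules as strict derivatives. *)
Lemma peval_strict_diff p u : strict_diff (peval p) u (pgrad p u).
Proof.
have sM q q' : strict_diff (peval q) u (pgrad q u) -> strict_diff (peval q') u (pgrad q' u) ->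
    strict_diff (peval (q * q')) u (pgrad (q * q') u).
  move=> s1 s2; apply: strict_diff_ext (strict_diffM s1 s2) => [x|]; first by rewrite pevalM.
  by rewrite pgradM.
have sC c : strict_diff (peval (mpoly.mpolyC n c)) u (pgrad (mpoly.mpolyC n c) u).
  by apply: strict_diff_ext (strict_diff_cst c u) => [x|]; rewrite ?pevalC ?pgradC.
have sX i : strict_diff (peval (mpoly.mpolyX K (mpoly.mnm1 i))) u
    (pgrad (mpoly.mpolyX K (mpoly.mnm1 i)) u).
  by apply: strict_diff_ext (strict_diff_coord i u) => [x|]; rewrite ?pevalXU ?pgradXU.
elim/mpoly.mpolyind: p => [|c m p _ _ IH]; first by rewrite -mpoly.mpolyC0.
rewrite -mpoly.mul_mpolyC.
have sm : strict_diff (peval (mpoly.mpolyX K m)) u (pgrad (mpoly.mpolyX K m) u).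
  rewrite mpoly.mpolyXE_id; apply: (big_ind (fun q => strict_diff (peval q) u (pgrad q u))).
  - by rewrite -mpoly.mpolyC1.
  - exact: sM.
  move=> i _; elim: (m i) => [|k IHk]; first by rewrite expr0 -mpoly.mpolyC1.
  by rewrite exprS; apply: sM.
have := strict_diffD (sM _ _ (sC c) sm) IH; rewrite -pgradD; apply: strict_diff_ext => // x.
by rewrite pevalD.
Qed.
End Polynomials.

(** * Convergent power series and their tails *)

Section PowerSeries.
Variables (R : realType) (s : scalar_kind) (n : nat).
Notation K := (scalars R s).
Notation poly := (mpoly.mpoly n K).
Implicit Types (g : 'rV[K]_n -> K) (p : nat -> poly) (x y u w a : 'rV[K]_n).

Lemma rabs_lim_le (z_ : nat -> K) z (c : R) : (z_ N @[N --> \oo] --> z) ->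
  (\forall N \near \oo, rabs (z_ N) <= c) -> rabs z <= c.
Proof.
move=> /cvg_rabs zz zc; apply/ler_addgt0Pr => e e0.
have /cvgr0Pnorm_lt /(_ e e0) ze := zz.
near \oo => N.
rewrite -(subKr (z_ N) z) (le_trans (rabsD _ _)) // rabsN lerD //; first by near: N.
have : `|rabs (z_ N - z)| < e by near: N.
by rewrite ger0_norm ?rabs_ge0 // => /ltW.
Unshelve. all: by end_near. Qed.

Definition ps_tail g a p k x : K := g (a + x) - \sum_(j < k) peval (p j) x.

Lemma ps_tailE g a p k x : power_series_at g a p ->
  forall N, (k <= N)%N ->
  \sum_(j < N) peval (p j) x - \sum_(j < k) peval (p j) x = \sum_(k <= j < N) peval (p j) x.
Proof.
move=> _ N kN; rewrite -!(big_mkord xpredT (fun j => peval (p j) x)) (big_cat_nat (leq0n k) kN) /=.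
by rewrite addrAC subrr add0r.
Qed.

Lemma homog_peval0 j (q : poly) : q \is mpoly.ishomog1 j.+1 mpoly.mdeg -> peval q 0 = 0.
Proof.
move=> hq; rewrite -[in LHS](scale0r (0 : 'rV[K]_n)) (peval_homog _ _ hq).
by rewrite expr0n mul0r.
Qed.

Lemma ps_coef_bound g a p : power_series_at g a p -> exists r M : R,
  [/\ 0 < r, 0 <= M, forall N, \sum_(j < N) pnorm (p j) * r ^+ j <= M
    & forall y, rnorm y < r ->
      (fun N : nat => \sum_(j < N) peval (p j) y) @ \oo --> g (a + y)].
Proof.
move=> [_ [_ [/gt0_rcst [r r0 ->] [M MP] cvgP]]]; exists r, (rabs M); split=> //.
- exact: rabs_ge0.
- move=> N; have M0 : 0 <= M by have := MP 0%N; rewrite big_ord0.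
  rewrite -(@rcst_le _ s) -norm_rabs ger0_norm // (le_trans _ (MP N)) //.
  rewrite rcst_sum ler_sum // => j _; rewrite rcstM rcstX rcst_sum mulr_suml.
  by under [leRHS]eq_bigr do rewrite norm_rabs.
- by move=> y yr; apply: cvgP; rewrite norm_rnorm rcst_lt.
Qed.

Lemma power_series_tail0 g a p k : power_series_at g a p -> ps_tail g a p k.+1 0 = 0.
Proof.
move=> gp; have [hp _] := gp.
have [r [M [r0 _ _ cvgP]]] := ps_coef_bound gp.
apply/eqP; rewrite -rabs_eq0 eq_le rabs_ge0 andbT.
have := cvgP 0; rewrite rnorm0 => /(_ r0) c0.
apply: (@rabs_lim_le (fun N => \sum_(j < N) peval (p j) 0 - \sum_(j < k.+1) peval (p j) 0)).
  by apply: cvgB c0 _; exact: cvg_cst.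
exists k.+1 => // N /= kN; rewrite (ps_tailE _ gp) // big_nat big1 ?rabs0 //.
by move=> [|j] // _; exact: homog_peval0.
Qed.

(** Differences of p_j cost j rho^(j-1), which the weights r^j absorb at half the radius: j < 2^j
    and rho <= r/2 give j rho^j <= (2/r)^(k+1) rho^(k+1) r^j for j > k, and summing the coefficient
    norms against r^j leaves M. *)
Lemma power_series_tail g a p k : power_series_at g a p -> exists C r : R,
  [/\ 0 <= C, 0 < r & forall rho x y, 0 < rho <= r -> rnorm x <= rho -> rnorm y <= rho ->
    rabs (ps_tail g a p k.+1 x - ps_tail g a p k.+1 y) <= C * rho ^+ k * rnorm (x - y)].
Proof.
move=> gp; have [hp _] := gp.
have [r [M [r0 M0 MP cvgP]]] := ps_coef_bound gp.
exists ((2 / r) ^+ k.+1 * M), (r / 2); split; last 1 first.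
- move=> rho x y /andP[rho0 rhor] xr yr.
  have lt_r z : rnorm z <= rho -> rnorm z < r.
    by move=> zr; apply: le_lt_trans zr (le_lt_trans rhor _); lra.
  apply: (@rabs_lim_le (fun N => \sum_(j < N) peval (p j) x - \sum_(j < k.+1) peval (p j) x
      - (\sum_(j < N) peval (p j) y - \sum_(j < k.+1) peval (p j) y))).
    by apply: cvgB; apply: cvgB; try exact: cvg_cst; apply: cvgP; exact: lt_r.
  exists k.+1 => // N /= kN; rewrite !(ps_tailE _ gp) // -sumrB.
  rewrite -(ler_pM2l rho0) (le_trans (ler_wpM2l (ltW rho0) (rabs_sum _ _ _))) //.
  rewrite mulr_sumr.
  apply: (@le_trans _ _ (\sum_(k.+1 <= j < N)
      (2 / r) ^+ k.+1 * rho ^+ k.+1 * rnorm (x - y) * (pnorm (p j) * r ^+ j))); last first.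
    rewrite -mulr_sumr.
    have -> : rho * ((2 / r) ^+ k.+1 * M * rho ^+ k * rnorm (x - y)) =
        (2 / r) ^+ k.+1 * rho ^+ k.+1 * rnorm (x - y) * M by rewrite [rho ^+ _.+1]exprS; ring.
    apply: ler_wpM2l; first by rewrite !mulr_ge0 ?exprn_ge0 ?rnorm_ge0 ?divr_ge0 ?ltW.
    apply: le_trans (MP N); rewrite -(big_mkord xpredT (fun j => pnorm (p j) * r ^+ j)).
    rewrite [leRHS](big_cat_nat (leq0n k.+1) kN) /= lerDr sumr_ge0 // => j _.
    by rewrite mulr_ge0 ?pnorm_ge0 ?exprn_ge0 ?ltW.
  rewrite !big_nat ler_sum // => j /andP[kj _].
  apply: le_trans (homog_lipschitz (hp j) (ltW rho0) xr yr) _.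
  rewrite [leRHS]mulrCA ler_wpM2l ?pnorm_ge0 // [leRHS]mulrAC ler_wpM2r ?rnorm_ge0 //.
  rewrite -(subnK kj); set i := (j - k.+1)%N.
  rewrite (exprD rho i) (exprD r i) expr_div_n.
  have rk : r ^+ k.+1 != 0 by rewrite expf_neq0 ?gt_eqF.
  have -> : 2 ^+ k.+1 / r ^+ k.+1 * rho ^+ k.+1 * (r ^+ i * r ^+ k.+1) =
      2 ^+ k.+1 * r ^+ i * rho ^+ k.+1 by field.
  rewrite mulrA; apply: ler_wpM2r; first by rewrite exprn_ge0 ?ltW.
  apply: (@le_trans _ _ ((2 ^ (i + k.+1))%:R * (r / 2) ^+ i)).
    apply: ler_pM => //; first by rewrite exprn_ge0 ?ltW.
      by rewrite ler_nat ltnW // ltn_expl.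
    by rewrite lerXn2r // nnegrE ltW // (lt_le_trans rho0).
  have two : (2 : R) ^+ i != 0 by rewrite expf_neq0.
  rewrite natrX exprD expr_div_n.
  have -> : 2 ^+ i * 2 ^+ k.+1 * (r ^+ i / 2 ^+ i) = 2 ^+ k.+1 * r ^+ i :> R by field.
  by [].
- by rewrite mulr_ge0 // exprn_ge0 // divr_ge0 // ltW.
- by rewrite divr_gt0.
Qed.
End PowerSeries.

(** * Rescaling a germ along a parabola *)

Section SecondOrderExpansion.
Variables (R : realType) (s : scalar_kind) (n : nat).
Notation K := (scalars R s).
Notation poly := (mpoly.mpoly n K).
Implicit Types (g : 'rV[K]_n -> K) (p : nat -> poly) (x y u w a : 'rV[K]_n).

Lemma pairing0r a : pairing a 0 = 0.
Proof. by rewrite -(scale0r (0 : 'rV[K]_n)) pairingZr mul0r. Qed.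

Lemma cvg_rnorm0 T (F : set_system T) (FF : Filter F) (f : T -> 'rV[K]_n) :
  (f x @[x --> F] --> (0 : 'rV[K]_n)) <-> (rnorm (f x) @[x --> F] --> (0 : R)).
Proof. by rewrite cvg_rnorm; under eq_fun do rewrite subr0. Qed.

Lemma power_series_tail_le g a p k : power_series_at g a p -> exists C r : R,
  [/\ 0 <= C, 0 < r & forall x, rnorm x <= r ->
    rabs (ps_tail g a p k.+1 x) <= C * rnorm x ^+ k.+1].
Proof.
move=> gp; have [C [r [C0 r0 CP]]] := power_series_tail k gp.
exists C, r; split=> // x xr; have t0 := power_series_tail0 k gp.
have [->|x0] := eqVneq x 0; first by rewrite t0 rabs0 mulr_ge0 ?exprn_ge0 ?rnorm_ge0.
have := CP (rnorm x) x 0; rewrite rnorm_gt0 x0 xr rnorm0 rnorm_ge0 lexx t0 !subr0.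
by rewrite exprSr mulrA; apply.
Qed.

Lemma lead_sum p m x : (forall j, (j < m)%N -> p j = 0) ->
  \sum_(j < m.+1) peval (p j) x = peval (p m) x.
Proof.
move=> p0; rewrite big_ord_recr /= big1 ?add0r // => j _.
by rewrite p0 ?peval0.
Qed.

(** Homogeneity gives p_m(b x) = b^m p_m(x), and g(x) = 0 makes p_m(x) equal to minus a tail of size
    O(|x|^(m+1)), so p_m(b x) = O(|b x|^m |x|) tends to 0. The scaling b is left arbitrary to cover
    both the tangent cone and the parabolas, where b = 1/t. *)
Lemma initial_form_zero g p m u (x : nat -> 'rV[K]_n) (b : nat -> K) :
  initial_degree g p m -> x k @[k --> \oo] --> (0 : 'rV[K]_n) ->
  (b k *: x k) @[k --> \oo] --> u -> (\forall k \near \oo, g (x k) = 0) ->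
  peval (p m) u = 0.
Proof.
move=> [gp _ p0] /cvg_rnorm0 x0 /cvg_rnorm yu gx; have [hp _] := gp.
have [C [r [C0 r0 CP]]] := power_series_tail_le m gp.
have [L L0 LP] := strict_diff_lipschitz (peval_strict_diff (p m) u).
apply/eqP; rewrite -rabs_eq0 eq_le rabs_ge0 andbT.
set D := C * (rnorm u + 1) ^+ m.
have D0 : 0 <= D by rewrite mulr_ge0 ?exprn_ge0 ?addr_ge0 ?rnorm_ge0.
apply: (@cvgr_to_ge _ \oo _ _ (fun k => D * rnorm (x k) + L * rnorm (b k *: x k - u))).
  rewrite -[X in _ --> X]addr0 -[X in _ --> X + _](mulr0 D) -[X in _ --> _ + X](mulr0 L).
  by apply: cvgD; apply: cvgM => //; exact: cvg_cst.
near=> k.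
have xr : rnorm (x k) <= r by near: k; apply: cvgr_le x0 _ r0.
have yu1 : rnorm (b k *: x k - u) <= 1 by near: k; apply: cvgr_le yu _ ltr01.
have gxk : g (x k) = 0 by near: k.
have tle := CP _ xr.
rewrite /ps_tail add0r gxk lead_sum // sub0r rabsN in tle.
rewrite -[peval (p m) u](subKr (peval (p m) (b k *: x k))) (le_trans (rabsD _ _)) // rabsN.
rewrite lerD //; last by apply: LP; rewrite ?subrr ?rnorm0.
rewrite (peval_homog _ _ (hp m)) rabsM rabsX.
apply: le_trans (ler_wpM2l (exprn_ge0 _ (rabs_ge0 _)) tle) _.
have -> : rabs (b k) ^+ m * (C * rnorm (x k) ^+ m.+1)
  = C * (rnorm (b k *: x k) ^+ m * rnorm (x k)) by rewrite rnormZ exprMn exprS; ring.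
rewrite /D -mulrA ler_wpM2l //.
rewrite ler_wpM2r ?rnorm_ge0 // lerXn2r ?nnegrE ?addr_ge0 ?rnorm_ge0 //.
by rewrite -(subrK u (b k *: x k)) addrC (le_trans (rnormD _ _)) // lerD.
Unshelve. all: by end_near. Qed.

(* The rescaling t^-(m+1) g(t u + t^2/2 w) minus its limit as t -> 0+. *)
Definition blowup g p m u (t : R) w : K :=
  (rcst s t)^-1 ^+ m.+1 * g (rcst s t *: u + (2^-1 * rcst s t ^+ 2) *: w)
  - (2^-1 * pairing (pgrad (p m) u) w + peval (p m.+1) u).

(** The summands of the constant come from the strict derivative of p_m at u (S B), the Lipschitz
    constant of p_{m+1} (L) and the tail from degree m + 2 (A D). The value at 0 and the differences
    are bounded separately because the contraction needs both. *)
Lemma blowup_bound g p m u (B : R) : 0 <= B ->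
  initial_degree g p m -> peval (p m) u = 0 -> exists2 C : R, 0 <= C &
  \forall t \near 0^'+, rabs (blowup g p m u t 0) <= C * t /\
    forall w w', rnorm w <= B -> rnorm w' <= B ->
    rabs (blowup g p m u t w - blowup g p m u t w') <= C * t * rnorm (w - w').
Proof.
move=> B0 [gp _ p0] pmu; have [hp _] := gp.
have [C [r [C0 r0 CP]]] := power_series_tail m.+1 gp.
have t0 := power_series_tail0 m.+1 gp.
have [L L0 LP] := strict_diff_lipschitz (peval_strict_diff (p m.+1) u).
have [S S0 SP] := peval_strict_diff (p m) u.
set D := rnorm u + B + 1.
have D0 : 0 < D by rewrite ltr_wpDl // addr_ge0 ?rnorm_ge0.
set A := C * D ^+ m.+1.
have A0 : 0 <= A by rewrite mulr_ge0 // exprn_ge0 // ltW.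
exists (S * B + L + A * D); first by rewrite !addr_ge0 // mulr_ge0 // ltW.
have d1 : 0 < r / D by rewrite divr_gt0.
have d2 : 0 < (B + 1)^-1 by rewrite invr_gt0 ltr_wpDl.
near=> t.
have tp : 0 < t by near: t; exact: nbhs_right_gt.
have t1 : t <= 1 by near: t; exact: nbhs_right_le.
have tr : t * D <= r by rewrite -ler_pdivlMr //; near: t; exact: nbhs_right_le.
(* Keeps u + t/2 w in the unit ball about u, where the strict derivative estimates hold. *)
have tB : t * B <= 1.
  apply: (@le_trans _ _ (t * (B + 1))); first by rewrite ler_pM2l // lerDl.
  by rewrite -ler_pdivlMr ?ltr_wpDl // div1r; near: t; exact: nbhs_right_le.
have tK : rcst s t != 0 by rewrite rcst_eq0 gt_eqF.
have rescale (P Q T : K) : (rcst s t)^-1 ^+ m.+1 *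
    (rcst s t ^+ m * P + rcst s t ^+ m.+1 * Q + T)
    = (rcst s t)^-1 * P + Q + (rcst s t)^-1 ^+ m.+1 * T.
  have e k : (rcst s t)^-1 ^+ k * rcst s t ^+ k = 1 by rewrite -exprMn mulVf // expr1n.
  rewrite !mulrDr [_ * (_ ^+ m.+1 * Q)]mulrA e mul1r.
  congr (_ + _ + _); rewrite exprS -mulrA; congr (_ * _).
  by rewrite mulrA e mul1r.
set X := fun w : 'rV[K]_n => rcst s t *: u + (2^-1 * rcst s t ^+ 2) *: w.
set Y := fun w : 'rV[K]_n => u + (2^-1 * rcst s t) *: w.
have XY w : X w = rcst s t *: Y w.
  by rewrite /X /Y scalerDr scalerA; congr (_ + _ *: _); ring.
have half : 2^-1 = rcst s 2^-1 :> K by rewrite rcstV -(rcst_nat R s 2).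
have rabs2 : rabs (2^-1 * rcst s t) = 2^-1 * t.
  by rewrite rabsM half !rabs_rcst gtr0_norm // gtr0_norm // invr_gt0.
have Yu w : rnorm w <= B -> rnorm (Y w - u) <= 2^-1 * (t * B).
  move=> wB; rewrite /Y addrC addKr rnormZ rabs2 -mulrA.
  by rewrite ler_wpM2l ?invr_ge0 // ler_wpM2l // ltW.
have Yu1 w : rnorm w <= B -> rnorm (Y w - u) <= 1.
  by move=> /Yu h; apply: le_trans h _; lra.
have Xr w : rnorm w <= B -> rnorm (X w) <= t * D.
  move=> wB; rewrite XY rnormZ rabs_rcst gtr0_norm //; apply: ler_wpM2l; first exact: ltW.
  rewrite -(subrK u (Y w)) addrC (le_trans (rnormD _ _)) //.
  by have := Yu1 _ wB; rewrite /D; lra.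
have XX w w' : rnorm (X w - X w') = 2^-1 * t ^+ 2 * rnorm (w - w').
  rewrite /X opprD addrACA subrr add0r -scalerBr rnormZ rabsM half rabs_rcst.
  by rewrite -rcstX rabs_rcst !ger0_norm ?invr_ge0 ?exprn_ge0 ?ltW.
have YY w w' : Y w - Y w' = (2^-1 * rcst s t) *: (w - w').
  by rewrite /Y opprD addrACA subrr add0r -scalerBr.
(* Homogeneity turns X w = t Y w into explicit powers of t; the first two terms carry the limit, and
   the tail starts in degree m + 2. *)
have gX w : (rcst s t)^-1 ^+ m.+1 * g (X w) = (rcst s t)^-1 * peval (p m) (Y w)
    + peval (p m.+1) (Y w) + (rcst s t)^-1 ^+ m.+1 * ps_tail g 0 p m.+2 (X w).
  have -> : g (X w) = rcst s t ^+ m * peval (p m) (Y w)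
      + rcst s t ^+ m.+1 * peval (p m.+1) (Y w) + ps_tail g 0 p m.+2 (X w).
    rewrite /ps_tail add0r big_ord_recr /= lead_sum // XY.
    by rewrite !(peval_homog _ _ (hp _)) [RHS]addrC subrK.
  exact: rescale.
have tail_le x y : rnorm x <= t * D -> rnorm y <= t * D ->
    rabs ((rcst s t)^-1 ^+ m.+1 * (ps_tail g 0 p m.+2 x - ps_tail g 0 p m.+2 y))
      <= A * rnorm (x - y).
  move=> xD yD; rewrite rabsM rabsX rabsV rabs_rcst gtr0_norm //.
  have tD : 0 < t * D <= r by rewrite mulr_gt0.
  apply: le_trans (ler_wpM2l _ (CP _ _ _ tD xD yD)) _.
    by rewrite exprn_ge0 // invr_ge0 ltW.
  have e : t^-1 ^+ m.+1 * t ^+ m.+1 = 1 by rewrite -exprMn mulVf ?gt_eqF // expr1n.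
  rewrite -[leRHS]mul1r -e exprMn /A le_eqVlt; apply/orP; left; apply/eqP; ring.
have b00 : rnorm (0 : 'rV[K]_n) <= B by rewrite rnorm0.
(* At w = 0 the point Y is u itself and p_m(u) = 0, so p_{m+1}(u) cancels against the limit and only
   the tail is left. *)
split.
  rewrite /blowup gX {1}/Y scaler0 addr0 pmu mulr0 add0r.
  have -> : Y 0 = u by rewrite /Y scaler0 addr0.
  rewrite pairing0r mulr0 add0r [_ + _ * ps_tail _ _ _ _ _]addrC addrK.
  have X0 : X 0 = rcst s t *: u by rewrite /X scaler0 addr0.
  have := tail_le _ _ (Xr _ b00); rewrite X0 => /(_ 0); rewrite rnorm0 t0 !subr0.
  move=> /(_ (mulr_ge0 (ltW tp) (ltW D0))) /le_trans; apply.
  rewrite rnormZ rabs_rcst gtr0_norm //.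
  have uD : rnorm u <= D by rewrite /D -addrA lerDl addr_ge0.
  have SB : 0 <= S * B by rewrite mulr_ge0.
  apply: (@le_trans _ _ (A * D * t)).
    by rewrite mulrCA mulrC ler_wpM2r ?(ltW tp) // ler_wpM2l.
  by rewrite ler_wpM2r ?(ltW tp) // lerDr addr_ge0.
move=> w w' wB wB'; rewrite /blowup !gX.
set N := rnorm (w - w'); have N0 : 0 <= N by exact: rnorm_ge0.
have tN : 0 <= t * N by rewrite mulr_ge0 // ltW.
have E1 := SP _ _ (Yu1 _ wB) (Yu1 _ wB').
have E2 := LP _ _ (Yu1 _ wB) (Yu1 _ wB').
have E3 := tail_le _ _ (Xr _ wB) (Xr _ wB').
rewrite YY pairingZr rnormZ rabs2 -/N in E1; rewrite YY rnormZ rabs2 -/N in E2.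
rewrite XX -/N in E3.
set q := pairing (pgrad (p m) u) in E1 *.
set P := peval (p m) in E1 *; set Q := peval (p m.+1) in E2 *.
set T := ps_tail g 0 p m.+2 in E3 *; set c := rcst s t in tK E1 E2 E3 *.
(* The pairing terms of the limit are the linear part of P / c along Y w - Y w', so subtracting them
   leaves the second-order remainder of P. *)
have -> : c^-1 * P (Y w) + Q (Y w) + c^-1 ^+ m.+1 * T (X w) - (2^-1 * q w + Q u)
  - (c^-1 * P (Y w') + Q (Y w') + c^-1 ^+ m.+1 * T (X w') - (2^-1 * q w' + Q u))
  = c^-1 * (P (Y w) - P (Y w') - 2^-1 * c * q (w - w')) + (Q (Y w) - Q (Y w'))
    + c^-1 ^+ m.+1 * (T (X w) - T (X w')).
  have -> : c^-1 * (P (Y w) - P (Y w') - 2^-1 * c * q (w - w'))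
    = c^-1 * (P (Y w) - P (Y w')) - 2^-1 * (q w - q w').
    by rewrite /q pairingBr mulrBr [2^-1 * c]mulrC -mulrA mulKf.
  by ring.
apply: le_trans (rabsD _ _) (le_trans (lerD (rabsD _ _) E3) _).
rewrite rabsM rabsV rabs_rcst gtr0_norm //.
have E1' : t^-1 * rabs (P (Y w) - P (Y w') - 2^-1 * c * q (w - w')) <= S * B * (t * N).
  rewrite ler_pdivrMl //; apply: le_trans E1 _.
  apply: (@le_trans _ _ (S * (t * B) * (t * N))).
    have := Yu _ wB; have := Yu _ wB' => h1 h2.
    apply: ler_pM; rewrite ?mulr_ge0 ?addr_ge0 ?rnorm_ge0 ?invr_ge0 ?(ltW tp) //.
      by rewrite ler_wpM2l //; lra.
    lra.
  by rewrite le_eqVlt; apply/orP; left; apply/eqP; ring.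
have E3' : A * (2^-1 * t ^+ 2 * N) <= A * D * (t * N).
  rewrite -[leRHS]mulrA ler_wpM2l //.
  have -> : 2^-1 * t ^+ 2 * N = 2^-1 * t * (t * N) by ring.
  rewrite ler_wpM2r // /D; have := rnorm_ge0 u; lra.
have E2' : rabs (Q (Y w) - Q (Y w')) <= L * (t * N).
  apply: le_trans E2 _; rewrite ler_wpM2l //; lra.
rewrite !mulrDl -!(mulrA _ t N) !lerD //.
Unshelve. all: by end_near. Qed.
End SecondOrderExpansion.

(** * Second-order tangent sets *)

Section TangentSets.
Variables (R : realType) (s : scalar_kind) (n : nat).
Notation K := (scalars R s).
Notation poly := (mpoly.mpoly n K).
Implicit Types (X : set 'rV[K]_n) (g : 'rV[K]_n -> K) (p : nat -> poly) (u w : 'rV[K]_n).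

Lemma decreases_to_0_real (t : nat -> K) : decreases_to_0 t ->
  exists tau : nat -> R,
    [/\ t = rcst s \o tau, forall k, 0 < tau k & tau k @[k --> \oo] --> (0 : R)].
Proof.
move=> [tp _ /cvg_rabs t0].
have tE k : t k = rcst s (rabs (t k)) by rewrite -norm_rabs gtr0_norm.
exists (fun k => rabs (t k)); split; first by apply/funext.
- by move=> k; rewrite -(@rcst_lt _ s) rcst0 -tE.
- by under eq_fun do rewrite -[t _]subr0.
Qed.

Lemma cvg_near_right (tau : nat -> R) (P : set R) : (forall k, 0 < tau k) ->
  tau k @[k --> \oo] --> (0 : R) -> (\forall t \near 0^'+, P t) ->
  \forall k \near \oo, P (tau k).
Proof.
move=> tp t0 P0; have H : \forall k \near \oo, 0 < tau k -> P (tau k) := t0 _ P0.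
by apply: filterS H => k; apply; exact: tp.
Qed.

Lemma parabola_cvg (t : nat -> K) (w_ : nat -> 'rV[K]_n) u w :
  decreases_to_0 t -> w_ k @[k --> \oo] --> w ->
  [/\ (t k *: u + (2^-1 * t k ^+ 2) *: w_ k) @[k --> \oo] --> (0 : 'rV[K]_n)
    & ((t k)^-1 *: (t k *: u + (2^-1 * t k ^+ 2) *: w_ k)) @[k --> \oo] --> u].
Proof.
move=> [tp _ t0] ww; split.
  rewrite -[X in _ --> X](addr0 0) -{1}(scale0r u) -(scale0r w).
  apply: cvgD; first by apply: cvgZ => //; exact: cvg_cst.
  apply: cvgZ => //; rewrite -[X in _ --> X](mulr0 2^-1).
  apply: cvgM; first exact: cvg_cst.
  by rewrite -(mulr0 0); exact: (cvgM t0 t0).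
have -> : (fun k => (t k)^-1 *: (t k *: u + (2^-1 * t k ^+ 2) *: w_ k)) =
  (fun k => u + (2^-1 * t k) *: w_ k).
  apply/funext => k; have tk : t k != 0 by rewrite gt_eqF.
  by rewrite scalerDr !scalerA mulVf // scale1r mulrCA expr2 mulKf.
rewrite -[X in _ --> X](addr0 u) -(scale0r w).
apply: cvgD; first exact: cvg_cst.
apply: cvgZ => //; rewrite -[X in _ --> X](mulr0 2^-1).
by apply: cvgM => //; exact: cvg_cst.
Qed.

Lemma tangent2_sub_alg X u : tangent2 X u `<=` tangent2_alg X u.
Proof.
move=> w [t [w_ [td ww Xx]]] g p m [_ gX] gpm.
have [x0 yu] := parabola_cvg u td ww.
have gx : \forall k \near \oo, g (t k *: u + (2^-1 * t k ^+ 2) *: w_ k) = 0.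
  have H : \forall k \near \oo, X (t k *: u + (2^-1 * t k ^+ 2) *: w_ k) ->
    g (t k *: u + (2^-1 * t k ^+ 2) *: w_ k) = 0 := x0 _ gX.
  by apply: filterS H => k; apply.
have pmu := initial_form_zero gpm x0 yu gx.
have [tau [tE tp tau0]] := decreases_to_0_real td.
have B0 : 0 <= rnorm w + 1 by rewrite addr_ge0 ?rnorm_ge0.
have [C C0 bl] := blowup_bound B0 gpm pmu.
have {}bl := cvg_near_right tp tau0 bl.
move/cvg_rnorm : ww => ww.
apply/eqP; rewrite -rabs_eq0 eq_le rabs_ge0 andbT.
set G := pgrad (p m) u; set B := rnorm w + 1 in B0 bl.
set D := n%:R * rnorm G.
apply: (@cvgr_to_ge _ \oo _ _
  (fun k => C * (1 + B) * tau k + rabs (2^-1 : K) * D * rnorm (w_ k - w))).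
  rewrite -[X in _ --> X]addr0 -[X in _ --> X + _](mulr0 (C * (1 + B))).
  rewrite -[X in _ --> _ + X](mulr0 (rabs (2^-1 : K) * D)).
  by apply: cvgD; apply: cvgM => //; exact: cvg_cst.
near=> k.
have ww1 : rnorm (w_ k - w) <= 1 by near: k; apply: cvgr_le ww _ ltr01.
have gk : g (t k *: u + (2^-1 * t k ^+ 2) *: w_ k) = 0 by near: k.
have [b0 bk] : rabs (blowup g p m u (tau k) 0) <= C * tau k /\
    forall w w', rnorm w <= B -> rnorm w' <= B ->
    rabs (blowup g p m u (tau k) w - blowup g p m u (tau k) w') <= C * tau k * rnorm (w - w').
  by near: k.
have wB : rnorm (w_ k) <= B.
  by rewrite -(subrK w (w_ k)) addrC (le_trans (rnormD _ _)) // lerD.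
have := bk _ 0 wB; rewrite rnorm0 subr0 => /(_ B0) {}bk.
(* Since g vanishes on the parabola, its blow-up at w_k is minus the limit expression at w_k; the
   blow-up is O(t), and passing from w_k to w costs O(|w_k - w|). *)
have -> : 2^-1 * pairing G w + peval (p m.+1) u =
   - (blowup g p m u (tau k) (w_ k) - blowup g p m u (tau k) 0) - blowup g p m u (tau k) 0
   - 2^-1 * pairing G (w_ k - w).
  have -> : blowup g p m u (tau k) (w_ k) = - (2^-1 * pairing G (w_ k) + peval (p m.+1) u).
    by rewrite /blowup; move: gk; rewrite tE /= => ->; rewrite mulr0 sub0r.
  by rewrite pairingBr; ring.
apply: le_trans (rabsD _ _) (le_trans (lerD (rabsD _ _) (lexx _)) _).
rewrite !rabsN rabsM lerD //; last first.
  by rewrite -mulrA ler_wpM2l ?rabs_ge0 //; exact: rabs_pairing.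
apply: le_trans (lerD bk b0) _.
have -> : C * (1 + B) * tau k = C * tau k * B + C * tau k by ring.
by rewrite lerD // ler_wpM2l // mulr_ge0 // ltW.
Unshelve. all: by end_near. Qed.

Lemma tangent_cone_initial_form X u g p m : tangent_cone X u ->
  vanishing_germ X g -> initial_degree g p m -> peval (p m) u = 0.
Proof.
move=> [x [t [Xx _ x0 txu]]] [_ gX] gpm; apply: (initial_form_zero gpm x0 txu).
have H : \forall k \near \oo, X (x k) -> g (x k) = 0 := x0 _ gX.
by apply: filterS H => k; apply; case: (Xx k).
Qed.

(** Sampling t along a decreasing sequence is enough, since the rate [C * t] forces the chosen w' to
    converge to w. *)
Lemma tangent2_intro X u w (C : R) :
  (\forall t \near 0^'+, exists2 w', rnorm (w' - w) <= C * t
     & X (rcst s t *: u + (2^-1 * rcst s t ^+ 2) *: w')) ->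
  tangent2 X u w.
Proof.
move=> /nbhs_ballP [d /= d0 dP].
(* [harmonic k] is at most 1, so the factor d / 2 keeps every tau k inside the ball on which the
   hypothesis holds. *)
pose tau k : R := (d / 2) * harmonic k.
have h0 k : 0 < (harmonic k : R) by rewrite /harmonic invr_gt0.
have h1 k : (harmonic k : R) <= 1 by rewrite /harmonic invf_le1 // ler1n.
have tp k : 0 < tau k by rewrite mulr_gt0 // divr_gt0.
have td k : tau k < d.
  apply: (@le_lt_trans _ _ (d / 2)); last by lra.
  by rewrite ler_piMr // divr_ge0 // ltW.
have ex k : exists w', rnorm (w' - w) <= C * tau k /\
     X (rcst s (tau k) *: u + (2^-1 * rcst s (tau k) ^+ 2) *: w').
  have [||w' ? ?] := dP (tau k) => //; last by exists w'.
  by rewrite /ball /= sub0r normrN gtr0_norm.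
have [w_ wP] := choice ex.
have tau0 : tau k @[k --> \oo] --> (0 : R).
  rewrite -[X in _ --> X](mulr0 (d / 2)); apply: cvgM; first exact: cvg_cst.
  exact: cvg_harmonic.
exists (rcst s \o tau), w_; split; last by move=> k; have [] := wP k.
- split=> [k|k|] /=.
  + by rewrite -(rcst0 R s) rcst_lt.
  + rewrite rcst_le ler_pM2l ?divr_gt0 // /harmonic lef_pV2 ?posrE //.
    by rewrite ler_nat.
  apply/cvg_rabs; under eq_fun do rewrite subr0 rabs_rcst gtr0_norm //.
  exact: tau0.
- apply/cvg_rnorm; apply: (squeeze_cvgr _ (@cvg_cst _ (0 : R) _ _ _)).
    by apply: nearW => k; rewrite rnorm_ge0; have [h _] := wP k; exact: h.
  by rewrite -[X in _ --> X](mulr0 C); apply: cvgM => //; exact: cvg_cst.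
Qed.
End TangentSets.

(** * Real coordinates on K^n, and a fixed point theorem over K *)

HB.instance Definition _ (R : realType) m n := Complete.on 'M[R]_(m, n).

Section RealCoordinates.
Variables (R : realType) (s : scalar_kind).
Notation K := (scalars R s).

Lemma rnorm_real n (y : 'rV[R]_n) : rnorm (s := RealScalars) y = `|y|.
Proof. by rewrite /rnorm /= normr_id. Qed.

Lemma to_realK n : cancel (@to_real R s n) (@of_real R s n).
Proof.
case: s => //= z; apply/rowP => j.
by rewrite mxE row_mxKl row_mxKr !mxE; case: (z 0 j).
Qed.

Lemma of_realK n : cancel (@of_real R s n) (@to_real R s n).
Proof.
case: s => //= y; rewrite -[RHS]hsubmxK; congr row_mx; apply/rowP => j; rewrite !mxE //.
Qed.

Lemma to_realD n (x y : 'rV[K]_n) : to_real (x + y) = to_real x + to_real y.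
Proof.
case: s x y => //= x y; rewrite add_row_mx; congr row_mx; apply/rowP => j; rewrite !mxE;
  by case: (x _ _) (y _ _) => [? ?] [? ?].
Qed.

Lemma to_realZ n (a : R) (x : 'rV[K]_n) : to_real (rcst s a *: x) = a *: to_real x.
Proof.
case: s x => //= x; rewrite scale_row_mx; congr row_mx; apply/rowP => j; rewrite !mxE.
  by case: (x _ _) => b c /=; ring.
by case: (x _ _) => b c /=; ring.
Qed.

Lemma to_realB n (x y : 'rV[K]_n) : to_real (x - y) = to_real x - to_real y.
Proof. by rewrite -scaleN1r -(rcst1 R s) -rcstN to_realD to_realZ scaleN1r. Qed.

Lemma to_real0 n : to_real (0 : 'rV[K]_n) = 0.
Proof. by rewrite -(subrr 0) to_realB subrr. Qed.

Lemma of_realB n (x y : 'rV[R]_(real_dim s n)) :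
  of_real (x - y) = of_real x - of_real y :> 'rV[K]_n.
Proof. by rewrite -[RHS]to_realK to_realB !of_realK. Qed.

Lemma of_real0 n : of_real 0 = 0 :> 'rV[K]_n.
Proof. by rewrite -to_real0 to_realK. Qed.

Lemma norm_to_real n (x : 'rV[K]_n) : `|to_real x| <= rnorm x.
Proof.
case: s x => x; first by rewrite rnorm_real.
rewrite -rnorm_real; apply: rnorm_le => [|i]; first exact: rnorm_ge0.
have := rabs_coord x match fintype.split i with inl j => j | inr j => j end.
apply: le_trans; rewrite /= mxE; case: (fintype.split i) => j; rewrite mxE /=.
  by case: (x 0 j) => a b /=; rewrite -sqrtr_sqr ler_wsqrtr // lerDl sqr_ge0.
by case: (x 0 j) => a b /=; rewrite -sqrtr_sqr ler_wsqrtr // lerDr sqr_ge0.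
Qed.

(** Over C the sharp constant is sqrt 2; 2 bounds it without a root. *)
Lemma rnorm_of_real n (y : 'rV[R]_(real_dim s n)) : rnorm (of_real y : 'rV[K]_n) <= 2 * `|y|.
Proof.
case: s y => y; first by rewrite rnorm_real /= ler_peMl // ler1n.
apply: rnorm_le => [|i]; first by rewrite mulr_ge0.
have yc j : `|y 0 j| <= `|y| by rewrite [leRHS]/Num.norm /= coord_le_mx_norm.
rewrite mxE /= !mxE; have := yc (lshift n i); have := yc (rshift n i).
set a := y 0 (lshift n i); set b := y 0 (rshift n i); set N := `|y|.
move=> bN aN; have N0 : 0 <= N by exact: normr_ge0.
rewrite -(ger0_norm (mulr_ge0 _ N0)) // -sqrtr_sqr ler_wsqrtr // exprMn.
have : a ^+ 2 <= N ^+ 2 by rewrite -(real_normK (num_real a)) lerXn2r // nnegrE.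
have : b ^+ 2 <= N ^+ 2 by rewrite -(real_normK (num_real b)) lerXn2r // nnegrE.
by have := sqr_ge0 N; lra.
Qed.

(** [to_real] and [of_real] together lose a factor 2, so the constant 1/4 over K becomes a
    contraction by 1/2 in real coordinates. It maps the ball of radius 2 c into itself, as 2 c / 2 +
    c = 2 c, and that ball corresponds to vectors of norm at most 4 c <= 1, where the Lipschitz
    hypothesis applies. *)
Lemma fixed_point_perturbation q (E : 'rV[K]_q -> 'rV[K]_q) (c : R) : 0 <= c -> c <= 4^-1 ->
  (forall v v', rnorm v <= 1 -> rnorm v' <= 1 -> rnorm (E v - E v') <= 4^-1 * rnorm (v - v')) ->
  rnorm (E 0) <= c -> exists2 v, rnorm v <= 4 * c & v = E v.
Proof.
move=> c0 c1 lip E0.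
pose F (y : 'rV[R]_(real_dim s q)) := to_real (E (of_real y)).
pose U := [set y : 'rV[R]_(real_dim s q) | `|y| <= 2 * c].
have U1 y : U y -> rnorm (of_real y : 'rV[K]_q) <= 1.
  by rewrite /U /= => yU; apply: le_trans (rnorm_of_real _) _; lra.
have U0 : U 0 by rewrite /U /= normr0 mulr_ge0.
have Flip y y' : U y -> U y' -> `|F y - F y'| <= 2^-1 * `|y - y'|.
  move=> yU y'U; rewrite /F -to_realB; apply: le_trans (norm_to_real _) _.
  apply: le_trans (lip _ _ (U1 _ yU) (U1 _ y'U)) _; rewrite -of_realB.
  by have := rnorm_of_real (y - y'); lra.
have FU : set_fun U U F.
  move=> y yU; rewrite /U /=; have := Flip _ _ yU U0; rewrite subr0 => h.
  have F0 : `|F 0| <= c by apply: le_trans (norm_to_real _) _; rewrite of_real0.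
  have := ler_distD 0 (F y) (F 0).
  have : `|F y| <= `|F y - F 0| + `|F 0|.
    by rewrite -{1}(subrK (F 0) (F y)) ler_normD.
  by move: yU; rewrite /U /=; lra.
pose F' : {fun U >-> U} := mkfun FU.
have ctr : is_contraction F'.
  exists 2^-1%:nng; split; first by rewrite /= invf_lt1 // ltr1n.
  by move=> [y y'] [/= yU y'U]; exact: Flip.
have clU : closed U.
  rewrite /U; apply: (@closed_comp _ _ (fun y : 'rV[R]_(real_dim s q) => `|y|) [set x | x <= 2 * c]).
    by move=> y _; exact: norm_continuous.
  exact: closed_le.
have [y yU yF] := banach_fixed_point ctr clU (ex_intro _ 0 U0).
exists (of_real y).
  by apply: le_trans (rnorm_of_real _) _; move: yU; rewrite /U /=; lra.
by rewrite {1}yF /= /F to_realK.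
Qed.
End RealCoordinates.

(** * Equations with independent initial gradients *)

Section Nondegenerate.
Variables (R : realType) (s : scalar_kind) (n : nat).
Notation K := (scalars R s).
Notation poly := (mpoly.mpoly n K).
Implicit Types (X : set 'rV[K]_n) (u w : 'rV[K]_n).

Lemma pairing_mulmx q (J : 'M[K]_(q, n)) (v : 'rV[K]_n) i :
  pairing (row i J) v = (v *m J^T) 0 i.
Proof. by rewrite mxE; apply: eq_bigr => k _; rewrite !mxE mulrC. Qed.

Lemma parabola_small u (B e : R) : 0 <= B -> 0 < e -> \forall t \near (0 : R)^'+,
  forall w, rnorm w <= B -> rnorm (rcst s t *: u + (2^-1 * rcst s t ^+ 2) *: w) < e.
Proof.
move=> B0 e0; set D := rnorm u + B + 1.
have D0 : 0 < D by rewrite ltr_wpDl // addr_ge0 ?rnorm_ge0.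
have d1 : 0 < e / D by rewrite divr_gt0.
near=> t.
have tp : 0 < t by near: t; exact: nbhs_right_gt.
have t1 : t <= 1 by near: t; exact: nbhs_right_le.
have tD : t * D < e by rewrite -ltr_pdivlMr //; near: t; exact: nbhs_right_lt.
move=> w wB; apply: le_lt_trans tD; apply: le_trans (rnormD _ _) _.
have half : 2^-1 = rcst s 2^-1 :> K by rewrite rcstV -(rcst_nat R s 2).
rewrite !rnormZ rabsM rabsX half !rabs_rcst gtr0_norm // gtr0_norm ?invr_gt0 //.
have -> : t * D = t * rnorm u + t * B + t by rewrite /D; ring.
rewrite -addrA lerD // (@le_trans _ _ (t * B)) //; last by rewrite lerDl ltW.
rewrite (@le_trans _ _ (t * rnorm w)) //; last by rewrite ler_wpM2l // ltW.
rewrite ler_wpM2r ?rnorm_ge0 // expr2 mulrA ler_piMl ?(ltW tp) //; lra.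
Unshelve. all: by end_near. Qed.

(** With independent gradients the q equations can be solved by moving w inside the q-dimensional
    range of a right inverse of the Jacobian, which reduces them to a fixed point problem in K^q. *)
Lemma nondegenerate_tangent2 q X u w (g : 'I_q -> 'rV[K]_n -> K)
    (p : 'I_q -> nat -> poly) (m : 'I_q -> nat) :
  (forall i, initial_degree (g i) (p i) (m i)) ->
  (forall i, peval (p i (m i)) u = 0) ->
  \rank (\matrix_(i < q) pgrad (p i (m i)) u) = q ->
  (\forall x \near (0 : 'rV[K]_n), X x <-> forall i, g i x = 0) ->
  (forall i, 2^-1 * pairing (pgrad (p i (m i)) u) w + peval (p i (m i).+1) u = 0) ->
  tangent2 X u w.
Proof.
move=> gp pu; set J := \matrix_(i < q) _ => rJ XP wE.
have JP : J *m pinvmx J = 1%:M by apply: mulmxVp; rewrite /row_free rJ.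
set P := (pinvmx J)^T.
set A : R := \sum_i \sum_j rabs (P i j).
have A0 : 0 <= A by do 2 apply: sumr_ge0 => ? _; exact: rabs_ge0.
have vP v : rnorm (v *m P) <= A * rnorm v by exact: rnorm_mulmx.
(* [P] is the transpose of a right inverse of the Jacobian, and 2 undoes the 1/2 in front of the
   pairing: as w solves the linear equations, their left sides at W v are exactly the coordinates of
   v. *)
pose W v := w + (2 : K) *: (v *m P).
have two : rabs (2 : K) = 2 by rewrite -(rcst_nat R s 2) rabs_rcst ger0_norm.
set B := rnorm w + 2 * A.
have B0 : 0 <= B by rewrite addr_ge0 ?rnorm_ge0 // mulr_ge0.
have WB v : rnorm v <= 1 -> rnorm (W v) <= B.
  move=> v1; apply: le_trans (rnormD _ _) _; rewrite lerD // rnormZ two ler_wpM2l //.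
  by apply: le_trans (vP v) _; rewrite ler_piMr.
have bl i := blowup_bound B0 (gp i) (pu i).
pose Q i (C : R) := 0 <= C /\ \forall t \near 0^'+,
    rabs (blowup (g i) (p i) (m i) u t 0) <= C * t /\
    forall w w', rnorm w <= B -> rnorm w' <= B ->
    rabs (blowup (g i) (p i) (m i) u t w - blowup (g i) (p i) (m i) u t w')
      <= C * t * rnorm (w - w').
have exQ i : exists C, Q i C by have [C C0 CP] := bl i; exists C.
have [Ci CiP] := choice exQ.
set C := \sum_i Ci i.
have CiC i : Ci i <= C.
  by rewrite /C (bigD1 i) //= lerDl sumr_ge0 // => j _; case: (CiP j).
have C0 : 0 <= C by apply: sumr_ge0 => i _; case: (CiP i).
set D := C * (1 + B).
have D0 : 0 <= D by rewrite mulr_ge0 // addr_ge0.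
have [e e0 XPe] := (nearE_rnorm _ _).1 XP.
have bl' := @filter_forall _ _ _ (0 : R)^'+ _ (fun i => (CiP i).2).
(* For t below these bounds, D t, which bounds E at 0, and 2 A C t, which is its Lipschitz constant,
   are both at most 1/4; the added 1 avoids a division by zero. *)
have d1 : 0 < (4 * (D + 1))^-1 by rewrite invr_gt0 mulr_gt0 // ltr_wpDl.
have d2 : 0 < (4 * (2 * A * C + 1))^-1.
  by rewrite invr_gt0 mulr_gt0 // ltr_wpDl // !mulr_ge0.
apply: (@tangent2_intro _ _ _ _ _ _ (2 * A * (4 * D))).
near=> t.
have tp : 0 < t by near: t; exact: nbhs_right_gt.
have tD : D * t <= 4^-1.
  apply: (@le_trans _ _ ((D + 1) * t)); first by rewrite ler_wpM2r ?(ltW tp) // lerDl.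
  rewrite -ler_pdivlMl ?ltr_wpDl // -invfM [_ * 4]mulrC.
  by near: t; exact: nbhs_right_le.
have tC : 2 * A * C * t <= 4^-1.
  apply: (@le_trans _ _ ((2 * A * C + 1) * t)); first by rewrite ler_wpM2r ?(ltW tp) // lerDl.
  rewrite -ler_pdivlMl ?ltr_wpDl ?mulr_ge0 // -invfM [_ * 4]mulrC.
  by near: t; exact: nbhs_right_le.
have small : forall w, rnorm w <= B -> rnorm (rcst s t *: u + (2^-1 * rcst s t ^+ 2) *: w) < e.
  by near: t; exact: parabola_small.
have {}bl : forall i, rabs (blowup (g i) (p i) (m i) u t 0) <= Ci i * t /\
    forall w w', rnorm w <= B -> rnorm w' <= B ->
    rabs (blowup (g i) (p i) (m i) u t w - blowup (g i) (p i) (m i) u t w')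
      <= Ci i * t * rnorm (w - w').
  by near: t; exact: bl'.
have tK : rcst s t != 0 by rewrite rcst_eq0 gt_eqF.
(* After rescaling, g_i vanishes at the corrected point exactly when v_i plus the i-th blow-up at W
   v is 0, that is, when v = E v. *)
pose E v := \row_i (- blowup (g i) (p i) (m i) u t (W v)).
have [|v v' v1 v2||v v4 vE] := @fixed_point_perturbation R s q E (D * t) _ tD.
- by rewrite mulr_ge0 // ltW.
- apply: rnorm_le => [|i]; first by rewrite mulr_ge0 ?rnorm_ge0 ?invr_ge0.
  rewrite !mxE -opprD rabsN.
  have [_ /(_ _ _ (WB _ v1) (WB _ v2))/le_trans] := bl i; apply.
  rewrite /W opprD addrACA subrr add0r -scalerBr -mulmxBl rnormZ two.
  apply: (@le_trans _ _ (C * t * (2 * (A * rnorm (v - v')))));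
    last by apply: le_trans (ler_wpM2r (rnorm_ge0 (v - v')) tC);
      rewrite le_eqVlt; apply/orP; left; apply/eqP; ring.
  by apply: ler_pM; rewrite ?mulr_ge0 ?rnorm_ge0 ?(ltW tp) ?ler_wpM2r ?(ltW tp)
    ?ler_wpM2l //; case: (CiP i).
- apply: rnorm_le => [|i]; first by rewrite mulr_ge0 // ltW.
  rewrite mxE rabsN.
  have [b0 bi] := bl i.
  have W0 : rnorm (W 0) <= B by apply: WB; rewrite rnorm0.
  have z0 : rnorm (0 : 'rV[K]_n) <= B by rewrite rnorm0.
  rewrite -(subrK (blowup (g i) (p i) (m i) u t 0) (blowup _ _ _ _ _ (W 0))).
  apply: le_trans (rabsD _ _) _.
  apply: le_trans (lerD (bi _ _ W0 z0) b0) _; rewrite subr0.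
  have -> : D * t = C * t * B + C * t by rewrite /D; ring.
  have CC : Ci i * t <= C * t by rewrite ler_wpM2r // ltW.
  rewrite lerD // ler_pM ?rnorm_ge0 // mulr_ge0 ?(ltW tp) //; by case: (CiP i).
have v1 : rnorm v <= 1 by lra.
exists (W v).
  rewrite /W addrC addKr rnormZ two -!mulrA ler_wpM2l //.
  by apply: le_trans (vP v) _; rewrite ler_wpM2l //; move: v4; rewrite /D !mulrA.
apply/XPe; first by rewrite subr0; apply: small; exact: WB.
move=> i; apply: (@mulfI _ ((rcst s t)^-1 ^+ (m i).+1)); first by rewrite expf_neq0 // invr_eq0.
rewrite mulr0; move/rowP : vE => /(_ i); rewrite mxE /blowup.
have -> : 2^-1 * pairing (pgrad (p i (m i)) u) (W v) + peval (p i (m i).+1) u = v 0 i.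
  rewrite /W pairingDr pairingZr mulrDr mulrA mulVf // mul1r addrAC wE add0r.
  have -> : pgrad (p i (m i)) u = row i J by rewrite rowK.
  by rewrite pairing_mulmx -mulmxA -trmx_mul JP trmx1 mulmx1.
by move=> h; rewrite -[LHS](subrK (v 0 i)) [X in _ + X]h subrr.
Unshelve. all: by end_near. Qed.
End Nondegenerate.

(** * Smooth points: charts and their transverse coordinates *)

Section Smooth.
Variables (R : realType) (s : scalar_kind) (n : nat).
Notation K := (scalars R s).
Notation poly := (mpoly.mpoly n K).
Implicit Types (X : set 'rV[K]_n) (g : 'rV[K]_n -> K) (a u w x y : 'rV[K]_n).

Lemma homog0_mpolyC (q : poly) : q \is mpoly.ishomog1 0 mpoly.mdeg ->
  q = mpoly.mpolyC n (mpoly.mcoeff (@mpoly.mnm0 n) q).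
Proof.
move=> hq; apply/mpoly.mpolyP => m; rewrite mpoly.mcoeffC.
have [->|m0] := eqVneq m mpoly.mnm0; first by rewrite mulr1.
by rewrite mulr0 (mpoly.dhomog_nemf_coeff hq) // mpoly.mdeg_eq0.
Qed.

Lemma power_series_at0 g a p : power_series_at g a p -> p 0%N = mpoly.mpolyC n (g a).
Proof.
move=> gp; have [hp _] := gp; have := power_series_tail0 0 gp.
rewrite /ps_tail addr0 big_ord1 => /eqP; rewrite subr_eq0 => /eqP ->.
by rewrite (homog0_mpolyC (hp 0%N)) pevalC.
Qed.

(** The tail beyond degree 0 has Lipschitz constant C rho^0, and the constant terms cancel. Stating
    it for all small r lets finitely many radii be chosen at once. *)
Lemma analytic_lipschitz g a : analytic_at g a -> exists2 C : R, 0 <= C &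
  \forall r \near (0 : R)^'+, forall x y, rnorm (x - a) <= r -> rnorm (y - a) <= r ->
    rabs (g x - g y) <= C * rnorm (x - y).
Proof.
move=> [p gp]; have [C [r0 [C0 r00 CP]]] := power_series_tail 0 gp.
exists C => //; near=> r => x y xr yr.
have r1 : 0 < r <= r0.
  by apply/andP; split; near: r; [exact: nbhs_right_gt|exact: nbhs_right_le].
have := CP _ _ _ r1 xr yr; rewrite expr0 mulr1 /ps_tail !big_ord1.
rewrite (power_series_at0 gp) !pevalC [a + _]addrC subrK [a + _]addrC subrK.
by rewrite !opprB !addrA !subrK.
Unshelve. all: by end_near. Qed.

Lemma analytic_map_lipschitz (psi : 'rV[K]_n -> 'rV[K]_n) a :
  (forall i, analytic_at (fun x => psi x 0 i) a) -> exists2 C : R, 0 <= C &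
  \forall r \near (0 : R)^'+, forall x y, rnorm (x - a) <= r -> rnorm (y - a) <= r ->
    rnorm (psi x - psi y) <= C * rnorm (x - y).
Proof.
move=> psia.
pose Q i (C : R) := 0 <= C /\ \forall r \near (0 : R)^'+,
  forall x y, rnorm (x - a) <= r -> rnorm (y - a) <= r ->
    rabs (psi x 0 i - psi y 0 i) <= C * rnorm (x - y).
have exQ i : exists C, Q i C by have [C C0 CP] := analytic_lipschitz (psia i); exists C.
have [C CP] := choice exQ.
have C0 : 0 <= \sum_i C i by apply: sumr_ge0 => i _; case: (CP i).
exists (\sum_i C i) => //.
have bl := @filter_forall _ _ _ (0 : R)^'+ _ (fun i => (CP i).2).
near=> r => x y xr yr; apply: rnorm_le => [|i].
  by rewrite mulr_ge0 ?rnorm_ge0.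
have H i' x' y' : rnorm (x' - a) <= r -> rnorm (y' - a) <= r ->
    rabs (psi x' 0 i' - psi y' 0 i') <= C i' * rnorm (x' - y').
  by move: i' x' y'; near: r; exact: bl.
rewrite !mxE; apply: le_trans (H i _ _ xr yr) _; rewrite ler_wpM2r ?rnorm_ge0 //.
by rewrite (bigD1 i) //= lerDl sumr_ge0 // => j _; case: (CP j).
Unshelve. all: by end_near. Qed.

Lemma blowup_le g p m u w : initial_degree g p m -> peval (p m) u = 0 ->
  exists2 C : R, 0 <= C & \forall t \near (0 : R)^'+, rabs (blowup g p m u t w) <= C * t.
Proof.
move=> gp pu; have [C C0 CP] := blowup_bound (rnorm_ge0 w) gp pu.
exists (C * (1 + rnorm w)); first by rewrite mulr_ge0 ?addr_ge0 ?rnorm_ge0.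
apply: filterS CP => t [b0 bw].
rewrite -(subrK (blowup g p m u t 0) (blowup g p m u t w)) (le_trans (rabsD _ _)) //.
have := bw w 0 (lexx _); rewrite rnorm0 subr0 => /(_ (rnorm_ge0 _)) b1.
by apply: le_trans (lerD b1 b0) _; rewrite le_eqVlt; apply/orP; left; apply/eqP; ring.
Qed.

(* The transverse coordinates of a chart have order one: phi_i = O(|x|^2) would contradict
   phi_i (psi y) = y_i for the Lipschitz inverse psi. *)
Lemma chart_linear_part_neq0 (W : set 'rV[K]_n) (phi psi : 'rV[K]_n -> 'rV[K]_n) p i :
  open W -> W (phi 0) -> psi (phi 0) = 0 ->
  (forall y, W y -> phi (psi y) = y) ->
  (forall j, analytic_at (fun y => psi y 0 j) (phi 0)) ->
  phi 0 0 i = 0 -> power_series_at (fun x => phi x 0 i) 0 p -> p 1%N != 0.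
Proof.
move=> oW Wb psib phipsi apsi phi0 php; apply/eqP => p1.
have [C [r [C0 r0 CP]]] := power_series_tail_le 1 php.
have [L L0 LP] := analytic_map_lipschitz apsi.
have [e e0 eW] := (nearE_rnorm _ _).1 (open_nbhs_nbhs (conj oW Wb)).
have d1 : 0 < r / (L + 1) by rewrite divr_gt0 // ltr_wpDl.
have d2 : 0 < (C * L ^+ 2 + 1)^-1 by rewrite invr_gt0 ltr_wpDl // mulr_ge0 ?exprn_ge0.
near (0 : R)^'+ => t.
have tp : 0 < t by near: t; exact: nbhs_right_gt.
have te : t < e by near: t; exact: nbhs_right_lt.
have tr : t * (L + 1) <= r by rewrite -ler_pdivlMr ?ltr_wpDl //; near: t; exact: nbhs_right_le.
have tC : t * (C * L ^+ 2 + 1) < 1.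
  rewrite -ltr_pdivlMr ?ltr_wpDl ?mulr_ge0 ?exprn_ge0 // div1r; near: t; exact: nbhs_right_lt.
have Lt : forall x y, rnorm (x - phi 0) <= t -> rnorm (y - phi 0) <= t ->
    rnorm (psi x - psi y) <= L * rnorm (x - y) by near: t.
pose y := phi 0 + rcst s t *: delta_mx 0 i.
have yb : rnorm (y - phi 0) <= t.
  rewrite /y addrC addKr rnormZ rabs_rcst gtr0_norm // ler_piMr ?(ltW tp) //.
  apply: rnorm_le => // j; rewrite !mxE eqxx /=.
  by case: (j == i); rewrite ?rabs1 ?rabs0.
have Wy : W y by apply: eW; apply: le_lt_trans te.
have psiy : rnorm (psi y) <= L * t.
  rewrite -[psi y]subr0 -psib; apply: le_trans (Lt _ _ yb _) _.
    by rewrite subrr rnorm0 ltW.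
  by rewrite ler_wpM2l.
have := CP (psi y); rewrite /ps_tail add0r phipsi // 2!big_ord_recl big_ord0 /=.
rewrite p1 (power_series_at0 php) phi0 !peval0 ?pevalC !(addr0, subr0).
rewrite !mxE phi0 add0r !eqxx mulr1 rabs_rcst gtr0_norm //.
have Lr : L * t <= r by apply: le_trans tr; rewrite mulrC ler_pM2l // lerDl.
move=> /(_ (le_trans psiy Lr)).
have : C * rnorm (psi y) ^+ 2 <= C * (L * t) ^+ 2.
  by rewrite ler_wpM2l // lerXn2r // nnegrE ?rnorm_ge0 // mulr_ge0 // ltW.
move=> /[swap] /le_trans /[apply]; rewrite leNgt => /negP; apply.
have -> : C * (L * t) ^+ 2 = (t * (C * L ^+ 2)) * t by ring.
by rewrite -[ltRHS]mul1r ltr_pM2r //; lra.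
Unshelve. all: by end_near. Qed.

(** Each transverse coordinate phi_i lies in I(X,0) and has order one, so its equation in T^{2,a}
    makes t^-2 phi_i(t u + t^2/2 w) an O(t). This cubic bound on phi_i is what leaves w displaced by
    only O(t) after division by t^2/2. *)
Lemma smooth_tangent2 X u w : X 0 -> smooth_at0 X -> tangent_cone X u ->
  tangent2_alg X u w -> tangent2 X u w.
Proof.
move=> X0 [U [d [oU U0 [_ /(_ 0 (conj X0 U0))]]]].
move=> [V [W [phi [psi [[oV oW] V0 VW WV [aphi apsi MV]]]]]] Tu wE.
have [Wb psib] := VW _ V0.
have phi0 (i : 'I_n) : (d <= i)%N -> phi 0 0 i = 0 by exact: ((MV _ V0).1 (conj X0 U0)).
have [e1 e10 e1V] := (nearE_rnorm _ _).1 (open_nbhs_nbhs (conj oV V0)).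
have [e2 e20 e2W] := (nearE_rnorm _ _).1 (open_nbhs_nbhs (conj oW Wb)).
have nearVU : \forall x \near (0 : 'rV[K]_n), V x /\ U x.
  by apply: filterI; apply: open_nbhs_nbhs.
have vg (i : 'I_n) : (d <= i)%N -> vanishing_germ X (fun x => phi x 0 i).
  move=> di; split; first by apply: filterS nearVU => x [Vx _]; exact: aphi.
  by apply: filterS nearVU => x [Vx Ux] Xx; exact: ((MV _ Vx).1 (conj Xx Ux)).
pose x_ (t : R) := rcst s t *: u + (2^-1 * rcst s t ^+ 2) *: w.
pose Q (i : 'I_n) (C : R) := 0 <= C /\ \forall t \near (0 : R)^'+, (d <= i)%N ->
  rabs (phi (x_ t) 0 i) <= C * t ^+ 3.
have exQ i : exists C, Q i C.
  have [id|di] := ltnP i d; first by exists 0; split=> //; near=> t; rewrite leqNgt id.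
  have [p pp] := aphi i _ V0.
  have ip : initial_degree (fun x => phi x 0 i) p 1.
    split=> [//||[|//] _]; last by rewrite (power_series_at0 pp) phi0 // mpoly.mpolyC0.
    apply: (chart_linear_part_neq0 oW Wb psib) pp => //; last exact: phi0.
    - by move=> y /WV[].
    - by move=> j; apply: apsi.
  have [C C0 CP] := blowup_le w ip (tangent_cone_initial_form Tu (vg _ di) ip).
  exists C; split=> //; near=> t => _.
  have tp : 0 < t by near: t; exact: nbhs_right_gt.
  have tK : rcst s t != 0 by rewrite rcst_eq0 gt_eqF.
  have : rabs (blowup (fun x => phi x 0 i) p 1 u t w) <= C * t by near: t.
  rewrite /blowup (wE _ _ _ (vg _ di) ip) subr0 rabsM rabsX rabsV rabs_rcst gtr0_norm //.
  rewrite exprVn ler_pdivrMl ?exprn_gt0 // => /le_trans; apply.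
  by rewrite le_eqVlt; apply/orP; left; apply/eqP; ring.
have [Ci CiP] := choice exQ.
set C := \sum_i Ci i.
have C0 : 0 <= C by apply: sumr_ge0 => i _; case: (CiP i).
have CiC i : Ci i <= C.
  by rewrite /C (bigD1 i) //= lerDl sumr_ge0 // => j _; case: (CiP j).
have bl := @filter_forall _ _ _ (0 : R)^'+ _ (fun i => (CiP i).2).
have [L L0 LP] := analytic_map_lipschitz (fun i => apsi i _ Wb).
have [M M0 MP] := analytic_map_lipschitz (fun i => aphi i _ V0).
(* The radius r on which phi and psi are Lipschitz is fixed before t, which is then taken small
   relative to it. *)
near (0 : R)^'+ => r.
have rp : 0 < r by near: r; exact: nbhs_right_gt.
have re2 : r < e2 by near: r; exact: nbhs_right_lt.
have Lt : forall x y, rnorm (x - phi 0) <= r -> rnorm (y - phi 0) <= r ->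
    rnorm (psi x - psi y) <= L * rnorm (x - y) by near: r.
have Mt : forall x y, rnorm (x - 0) <= r -> rnorm (y - 0) <= r ->
    rnorm (phi x - phi y) <= M * rnorm (x - y) by near: r.
have d1 : 0 < r / (2 * (M + 1)) by rewrite divr_gt0 // mulr_gt0 // ltr_wpDl.
have d2 : 0 < r / (2 * (C + 1)) by rewrite divr_gt0 // mulr_gt0 // ltr_wpDl.
have small1 := parabola_small u (rnorm_ge0 w) e10.
have smallr := parabola_small u (rnorm_ge0 w) rp.
have smallM := parabola_small u (rnorm_ge0 w) d1.
apply: (@tangent2_intro _ _ _ _ _ _ (2 * (L * C))).
near=> t.
have tp : 0 < t by near: t; exact: nbhs_right_gt.
have t1 : t <= 1 by near: t; exact: nbhs_right_le.
have tC : t * (2 * (C + 1)) <= r.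
  by rewrite -ler_pdivlMr ?mulr_gt0 ?ltr_wpDl //; near: t; exact: nbhs_right_le.
have xt1 : rnorm (x_ t) < e1.
  suff : forall w', rnorm w' <= rnorm w ->
    rnorm (rcst s t *: u + (2^-1 * rcst s t ^+ 2) *: w') < e1 by move=> /(_ w); exact.
  by near: t.
have xtr : rnorm (x_ t) < r.
  suff : forall w', rnorm w' <= rnorm w ->
    rnorm (rcst s t *: u + (2^-1 * rcst s t ^+ 2) *: w') < r by move=> /(_ w); exact.
  by near: t.
have xtM : rnorm (x_ t) < r / (2 * (M + 1)).
  suff : forall w', rnorm w' <= rnorm w ->
    rnorm (rcst s t *: u + (2^-1 * rcst s t ^+ 2) *: w') < r / (2 * (M + 1))
    by move=> /(_ w); exact.
  by near: t.
have phit : forall i : 'I_n, (d <= i)%N -> rabs (phi (x_ t) 0 i) <= Ci i * t ^+ 3.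
  by near: t; exact: bl.
have Vx : V (x_ t) by apply: e1V; rewrite subr0.
have [_ psix] := VW _ Vx.
pose y := \row_(i < n) (if (i < d)%N then phi (x_ t) 0 i else 0).
have yphi : rnorm (y - phi (x_ t)) <= C * t ^+ 3.
  have t3 : 0 <= t ^+ 3 by rewrite exprn_ge0 // ltW.
  apply: rnorm_le => [|i]; first by rewrite mulr_ge0.
  rewrite !mxE; have [id|di] := ltnP i d; first by rewrite subrr rabs0 mulr_ge0.
  rewrite sub0r rabsN; apply: le_trans (phit _ di) _; by rewrite ler_wpM2r.
(* One r / 2 here and another in [Ct3] keep y within r of phi 0, hence inside W and where psi is
   Lipschitz. *)
have phib : rnorm (phi (x_ t) - phi 0) <= r / 2.
  apply: le_trans (Mt _ _ _ _) _; rewrite ?subr0 ?rnorm0 ?ltW //.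
  set q := r / (2 * (M + 1)) in xtM d1.
  have qE : (M + 1) * q = r / 2.
    by rewrite /q; field; rewrite gt_eqF // ltr_wpDl.
  have : M * rnorm (x_ t) <= M * q by rewrite ler_wpM2l // ltW.
  by move: qE; rewrite mulrDl mul1r; lra.
have Ct3 : C * t ^+ 3 <= r / 2.
  have : C * t ^+ 3 <= C * t.
    by rewrite ler_wpM2l // exprS ler_piMr ?(ltW tp) // exprn_ile1 // ltW.
  have : 0 <= C * t by rewrite mulr_ge0 // ltW.
  by move: tC; rewrite mulrC -mulrA mulrDl mul1r; lra.
have yb : rnorm (y - phi 0) <= r.
  have := rnormD (y - phi (x_ t)) (phi (x_ t) - phi 0); rewrite addrA subrK; lra.
have Wy : W y by apply: e2W; exact: le_lt_trans re2.
have [Vy phiy] := WV _ Wy.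
have tK : rcst s t != 0 by rewrite rcst_eq0 gt_eqF.
have two : (2 : K) != 0 by rewrite pnatr_eq0.
(* This w' makes the parabola hit psi y exactly; its distance to w is 2 t^-2 |psi y - x_t| <= 2 t^-2
   L C t^3. *)
exists (w + (2 * (rcst s t)^-1 ^+ 2) *: (psi y - x_ t)).
  rewrite addrC addKr rnormZ rabsM rabsX rabsV rabs_rcst gtr0_norm //.
  rewrite -(rcst_nat R s 2) rabs_rcst ger0_norm // -!mulrA; apply: ler_wpM2l => //.
  rewrite mulrA -invfM ler_pdivrMl ?mulr_gt0 // -{1}psix.
  apply: le_trans (Lt _ _ yb _) _;
    first by rewrite (le_trans phib) // ler_pdivrMr // ler_peMr ?(ltW rp) // ler1n.
  apply: le_trans (ler_wpM2l L0 yphi) _; rewrite le_eqVlt; apply/orP; left; apply/eqP; ring.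
have -> : rcst s t *: u + (2^-1 * rcst s t ^+ 2) *: (w + (2 * (rcst s t)^-1 ^+ 2) *: (psi y - x_ t))
    = psi y.
  rewrite scalerDr addrA scalerA -/(x_ t).
  have -> : 2^-1 * rcst s t ^+ 2 * (2 * (rcst s t)^-1 ^+ 2) = 1.
    by rewrite exprVn mulrACA mulVf // mulfV ?expf_neq0 // mul1r.
  by rewrite scale1r addrC subrK.
by apply: ((MV _ Vy).2 _).1 => i di; rewrite phiy mxE ltnNge di.
Unshelve. all: by end_near. Qed.
End Smooth.

(** * Second-order expansion of a C2 function *)

Section Taylor.
Variables (R : realType) (N : nat).
Implicit Types (G F : 'rV[R]_N -> R) (a b v x y h : 'rV[R]_N).

Lemma line_derive G b v (t : R) : derivable G (b + t *: v) v ->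
  is_derive t 1 (fun r => G (b + r *: v)) ('D_v G (b + t *: v)).
Proof.
move=> dG; set H := fun r : R => _.
have e : (fun h : R => h^-1 *: ((H \o shift t) (h *: 1) - H t)) =
    (fun h : R => h^-1 *: ((G \o shift (b + t *: v)) (h *: v) - G (b + t *: v))).
  apply/funext => h; congr (_ *: (G _ - _)).
  by rewrite /= [h *: 1]mulr1 scalerDl addrCA.
by split; rewrite ?/derivable ?/derive e.
Qed.

Lemma mvt_segment0 (H dH : R -> R) (t : R) : (forall r : R, is_derive r 1 H (dH r)) ->
  exists2 c, `|c| <= `|t| & H t - H 0 = t * dH c.
Proof.
move=> dHP.
have cH : continuous H.
  by move=> r; apply/differentiable_continuous/derivable1_diffP; case: (dHP r).
have cS p q : {within `[p, q], continuous H} by apply: continuous_subspaceT.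
have [t0|t0] := leP 0 t.
  have [c] := MVT_segment t0 (fun r _ => dHP r) (cS _ _).
  rewrite in_itv /= => /andP[c0 ct] e; exists c; first by rewrite !ger0_norm.
  by rewrite e subr0 mulrC.
have [c] := MVT_segment (ltW t0) (fun r _ => dHP r) (cS _ _).
rewrite in_itv /= => /andP[c0 ct] e; exists c; first by rewrite !ler0_norm ?lerN2 // ltW.
by rewrite -opprB e sub0r mulrN opprK mulrC.
Qed.

Lemma norm_coord x i : `|x 0 i| <= `|x|.
Proof. by rewrite [leRHS]/Num.norm /= coord_le_mx_norm. Qed.

Lemma norm_row_le x (c : R) : 0 <= c -> (forall i, `|x 0 i| <= c) -> `|x| <= c.
Proof. by move=> c0 xc; rewrite -rnorm_real; apply: rnorm_le. Qed.

Lemma near_norm a (P : set 'rV[R]_N) : (\forall x \near a, P x) ->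
  exists2 e : R, 0 < e & forall x, `|x - a| < e -> P x.
Proof.
move=> /(nearE_rnorm (s := RealScalars)) [e e0 eP]; exists e => // x xa.
by apply: eP; rewrite rnorm_real.
Qed.

Lemma near0_norm (e : R) : 0 < e -> \forall x \near (0 : 'rV[R]_N), `|x| < e.
Proof.
move=> e0; apply/(nearE_rnorm (s := RealScalars)); exists e => // x.
by rewrite rnorm_real subr0.
Qed.

(** [C1] speaks of partial derivatives only, so h is reached one coordinate at a time, each step
    being a one-variable mean value; every intermediate point stays within |h| of a in the sup
    norm. *)
Lemma C1_expansion G a (e : R) : C1 G -> 0 < e ->
  \forall h \near (0 : 'rV[R]_N),
    `|G (a + h) - G a - pairing (gradient G a) h| <= e * `|h|.
Proof.
move=> [dG cG] e0.
(* N + 1 instead of N keeps e' positive when N = 0; the N steps together then cost at most e |h|. *)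
set e' := e / N.+1%:R.
have e'0 : 0 < e' by rewrite divr_gt0.
have near_a : \forall x \near a, forall i : 'I_N,
    `|'D_(delta_mx 0 i) G a - 'D_(delta_mx 0 i) G x| < e'.
  apply: (@filter_forall _ _
    (fun i x => `|'D_(delta_mx 0 i) G a - 'D_(delta_mx 0 i) G x| < e') (nbhs a)) => i.
  by have /cvgrPdist_lt := cG i a; exact.
have [d d0 dP] := near_norm near_a.
apply: filterS (near0_norm d0) => h hd.
pose hk k := \row_(i < N) (if (i < k)%N then h 0 i else 0).
have hkN : hk N = h by apply/rowP => i; rewrite mxE ltn_ord.
have hk0 : hk 0%N = 0 by apply/rowP => i; rewrite !mxE.
have hkS (k : 'I_N) : hk k.+1 = hk k + h 0 k *: delta_mx 0 k.
  apply/rowP => i; rewrite !mxE eqxx /= ltnS leq_eqVlt -val_eqE /=.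
  have [/val_inj ->|ik] := eqVneq (val i) (val k); first by rewrite ltnn add0r mulr1.
  by rewrite mulr0 addr0.
have step (k : 'I_N) :
    `|G (a + hk k.+1) - G (a + hk k) - 'D_(delta_mx 0 k) G a * h 0 k| <= e' * `|h|.
  have [c ch ->] : exists2 c, `|c| <= `|h 0 k| &
      G (a + hk k.+1) - G (a + hk k) = h 0 k * 'D_(delta_mx 0 k) G (a + hk k + c *: delta_mx 0 k).
    have [c ch cE] := mvt_segment0 (h 0 k)
      (fun r => line_derive (dG k (a + hk k + r *: delta_mx 0 k))).
    by exists c => //; rewrite -cE scale0r addr0 -addrA -hkS.
  rewrite mulrC -mulrBl normrM distrC ler_pM // ?norm_coord // ltW //.
  apply: dP; apply: le_lt_trans hd; rewrite -(addrA a) [a + _]addrC addrK.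
  apply: norm_row_le => // i; rewrite !mxE eqxx /=.
  have [ik|ik] := eqVneq i k.
    by rewrite ik ltnn add0r mulr1 (le_trans ch) // norm_coord.
  by rewrite mulr0 addr0; case: ifP => _; rewrite ?normr0 // norm_coord.
have -> : G (a + h) - G a - pairing (gradient G a) h =
    \sum_(k < N) (G (a + hk k.+1) - G (a + hk k) - 'D_(delta_mx 0 k) G a * h 0 k).
  rewrite sumrB -(big_mkord xpredT (fun k => G (a + hk k.+1) - G (a + hk k))).
  rewrite telescope_sumr // hkN hk0 addr0; congr (_ - _).
  by apply: eq_bigr => i _; rewrite mxE.
apply: le_trans (ler_norm_sum _ _ _) _.
apply: le_trans (ler_sum _ (fun k _ => step k)) _.
rewrite sumr_const card_ord -mulr_natl mulrA ler_wpM2r // /e' mulrCA ler_piMr ?(ltW e0) //.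
by rewrite ler_pdivrMr // mul1r ler_nat.
Qed.

Lemma C1_is_derive G a v : C1 G -> is_derive a v G (pairing (gradient G a) v).
Proof.
move=> cG.
suff H : (fun h : R => h^-1 *: ((G \o shift a) (h *: v) - G a)) @ 0^' --> pairing (gradient G a) v.
  by split; [apply/cvg_ex; exists (pairing (gradient G a) v)|exact: cvg_lim H].
apply/cvgrPdist_le => e e0.
have e1 : 0 < e / (`|v| + 1) by rewrite divr_gt0 // ltr_wpDl.
have [d d0 dP] := near_norm (C1_expansion a cG e1).
have d1 : 0 < d / (`|v| + 1) by rewrite divr_gt0 // ltr_wpDl.
near=> t.
have t0 : t != 0 by near: t; exact: nbhs_dnbhs_neq.
have td : `|t| < d / (`|v| + 1) by near: t; exact: dnbhs0_lt.
have tv : `|t *: v - 0| < d.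
  rewrite subr0 normrZ; apply: (@le_lt_trans _ _ (`|t| * (`|v| + 1))).
    by rewrite ler_wpM2l // lerDl.
  by rewrite -ltr_pdivlMr // ltr_wpDl.
have := dP _ tv; rewrite normrZ /= [t *: v + a]addrC => h.
have -> : pairing (gradient G a) v - t^-1 *: (G (a + t *: v) - G a) =
  - (t^-1 * (G (a + t *: v) - G a - pairing (gradient G a) (t *: v))).
  have -> : pairing (gradient G a) (t *: v) = t * pairing (gradient G a) v.
    exact: (@pairingZr R RealScalars).
  by rewrite [in RHS]mulrBr mulKf // opprB.
rewrite normrN normrM normfV ler_pdivrMl ?normr_gt0 //; apply: le_trans h _.
rewrite mulrCA ler_wpM2l // -mulrA ler_piMr ?(ltW e0) //.
by rewrite mulrC ler_pdivrMr ?ltr_wpDl // mul1r lerDl.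
Unshelve. all: by end_near. Qed.

(** The mean value theorem is applied once, to F(t x) minus its quadratic model in t: the derivative
    at c is a sum of x_i times the first-order remainder of the i-th partial derivative at c x,
    which [C1_expansion] bounds. *)
Lemma C2_expansion F (e : R) : C2 F -> 0 < e ->
  \forall x \near (0 : 'rV[R]_N),
    `|F x - F 0 - pairing (gradient F 0) x - 2^-1 * pairing x (x *m (hessian F 0)^T)|
      <= e * `|x| ^+ 2.
Proof.
move=> [cF cdF] e0.
set e' := e / N.+1%:R.
have e'0 : 0 < e' by rewrite divr_gt0.
have near0 : \forall x \near (0 : 'rV[R]_N), forall i : 'I_N,
    `|'D_(delta_mx 0 i) F x - 'D_(delta_mx 0 i) F 0
      - pairing (gradient ('D_(delta_mx 0 i) F) 0) x| <= e' * `|x|.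
  apply: (@filter_forall _ _ (fun i x => `|'D_(delta_mx 0 i) F x - 'D_(delta_mx 0 i) F 0
      - pairing (gradient ('D_(delta_mx 0 i) F) 0) x| <= e' * `|x|) (nbhs (0 : 'rV[R]_N))) => i.
  by apply: filterS (C1_expansion 0 (cdF i) e'0) => h; rewrite add0r.
have [d d0 dP] := near_norm near0.
apply: filterS (near0_norm d0) => x xd.
set A := pairing (gradient F 0) x; set Q := pairing x _.
pose H (t : R) := F (t *: x) - t * A - 2^-1 * t ^+ 2 * Q.
pose dH (t : R) := pairing (gradient F (t *: x)) x - A - t * Q.
have dHP : forall t : R, is_derive t 1 H (dH t).
  move=> t; have [dF eF] := C1_is_derive (0 + t *: x) x cF.
  have h1 := line_derive dF.
  have -> : H = (fun r => F (0 + r *: x)) - A *: (id : R -> R) - (2^-1 * Q) *: ((id : R -> R) ^+ 2).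
    by apply/funext => r; rewrite /H !fctE /= add0r /GRing.scale /=; ring.
  apply: is_derive_eq; rewrite eF add0r /dH /GRing.scale /= expr1; lra.
have [c c1] := mvt_segment0 1 dHP.
rewrite normr1 in c1.
rewrite mul1r /H scale1r scale0r expr1n expr0n /= !mulr0 !mul0r mulr1 !subr0 mul1r => HE.
have -> : F x - F 0 - A - 2^-1 * Q = dH c by rewrite -HE; ring.
(* Row i of the hessian holds the D_i D_j F, whereas the gradient of the i-th partial derivative
   holds the D_j D_i F; exchanging the two sums matches them. *)
have QE : Q = \sum_i x 0 i * pairing (gradient ('D_(delta_mx 0 i) F) 0) x.
  rewrite /Q /pairing.
  under eq_bigr do rewrite mxE mulr_sumr.
  rewrite exchange_big /=; apply: eq_bigr => i _; rewrite mulr_sumr.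
  by apply: eq_bigr => j _; rewrite !mxE; ring.
have -> : dH c = \sum_i x 0 i * ('D_(delta_mx 0 i) F (c *: x) - 'D_(delta_mx 0 i) F 0
      - pairing (gradient ('D_(delta_mx 0 i) F) 0) (c *: x)).
  rewrite /dH QE mulr_sumr /A /pairing -!sumrB; apply: eq_bigr => i _.
  rewrite !mxE.
  have -> : \sum_j (gradient ('D_(delta_mx 0 i) F) 0) 0 j * (c *: x) 0 j =
     c * \sum_j (gradient ('D_(delta_mx 0 i) F) 0) 0 j * x 0 j.
    exact: (@pairingZr R RealScalars).
  by ring.
have cx : `|c *: x - 0| < d.
  by rewrite subr0 normrZ; apply: le_lt_trans xd; rewrite ler_piMl.
have {}dP := dP _ cx.
apply: le_trans (ler_norm_sum _ _ _) _.
apply: (@le_trans _ _ (\sum_(i < N) `|x| * (e' * `|x|))).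
  apply: ler_sum => i _; rewrite normrM ler_pM ?norm_coord //.
  apply: le_trans (dP i) _; rewrite ler_wpM2l ?(ltW e'0) // normrZ ler_piMl //.
rewrite sumr_const card_ord -mulr_natl.
have -> : N%:R * (`|x| * (e' * `|x|)) = (N%:R * e') * `|x| ^+ 2 by ring.
rewrite ler_wpM2r ?exprn_ge0 // /e' mulrCA ler_piMr ?(ltW e0) //.
by rewrite ler_pdivrMr // mul1r ler_nat.
Qed.
End Taylor.

(** * First- and second-order behaviour of the objective on K^n *)

Section Objective.
Variables (R : realType) (s : scalar_kind) (n : nat).
Notation K := (scalars R s).
Implicit Types (f : 'rV[K]_n -> R) (u v w x y : 'rV[K]_n).

Lemma slopeD f x y : slope f (x + y) = slope f x + slope f y.
Proof. by rewrite /slope to_realD; exact: (@pairingDr R RealScalars). Qed.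

Lemma slopeZ f (a : R) x : slope f (rcst s a *: x) = a * slope f x.
Proof. by rewrite /slope to_realZ; exact: (@pairingZr R RealScalars). Qed.

Lemma slopeB f x y : slope f (x - y) = slope f x - slope f y.
Proof. by rewrite slopeD -scaleN1r -(rcst1 R s) -rcstN slopeZ mulN1r. Qed.

Lemma slope_at0 f : slope f (0 : 'rV[K]_n) = 0.
Proof. by rewrite -(subrr 0) slopeB subrr. Qed.

Lemma curvatureZ f (a : R) x : curvature f (rcst s a *: x) = a ^+ 2 * curvature f x.
Proof.
rewrite /curvature to_realZ -scalemxAl expr2 -mulrA.
rewrite (@pairingZl R RealScalars); congr (_ * _).
exact: (@pairingZr R RealScalars).
Qed.

Lemma slope_bounded f : exists2 S : R, 0 <= S & forall x, `|slope f x| <= S * rnorm x.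
Proof.
set G := gradient (f \o @of_real R s n) 0.
exists ((real_dim s n)%:R * `|G|); first by rewrite mulr_ge0.
move=> x; have := @rabs_pairing R RealScalars _ G (to_real x).
rewrite !rnorm_real => /le_trans; apply.
by rewrite ler_wpM2l ?mulr_ge0 // norm_to_real.
Qed.

Lemma curvature_lipschitz f : exists2 C : R, 0 <= C & forall x y,
  `|curvature f x - curvature f y| <= C * (rnorm x + rnorm y) * rnorm (x - y).
Proof.
set N := real_dim s n.
set H := (hessian (f \o @of_real R s n) 0)^T.
set A := \sum_i \sum_j `|H i j|.
have A0 : 0 <= A by do 2 apply: sumr_ge0 => ? _.
exists (N%:R * A); first by rewrite mulr_ge0.
move=> x y; rewrite /curvature -/H.
have -> : pairing (to_real x) (to_real x *m H) - pairing (to_real y) (to_real y *m H) =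
   pairing (to_real x) (to_real (x - y) *m H) + pairing (to_real (x - y)) (to_real y *m H).
  rewrite to_realB mulmxBl (@pairingBr R RealScalars).
  rewrite (@pairingDl R RealScalars) -[- to_real y]scaleN1r (@pairingZl R RealScalars).
  by rewrite mulN1r addrA subrK.
have le a b : `|pairing (to_real a) (to_real b *m H)| <= N%:R * A * (rnorm a * rnorm b).
  have := @rabs_pairing R RealScalars _ (to_real a) (to_real b *m H).
  rewrite !rnorm_real => /le_trans; apply.
  have := @rnorm_mulmx R RealScalars _ _ (to_real b) H; rewrite !rnorm_real => bH.
  rewrite -!mulrA ler_wpM2l // [leRHS]mulrCA ler_pM // ?norm_to_real //.
  by apply: le_trans bH _; rewrite ler_wpM2l // norm_to_real.
apply: le_trans (ler_normD _ _) (le_trans (lerD (le _ _) (le _ _)) _).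
by rewrite le_eqVlt; apply/orP; left; apply/eqP; ring.
Qed.

Lemma curvature_bounded f : exists2 C : R, 0 <= C & forall x,
  `|curvature f x| <= C * rnorm x ^+ 2.
Proof.
have [C C0 CP] := curvature_lipschitz f; exists C => // x.
have := CP x 0; rewrite rnorm0 addr0 subr0.
have := curvatureZ f 0 0; rewrite expr0n mul0r scaler0 => ->.
by rewrite subr0 expr2 mulrA.
Qed.

Lemma objective_expansion f (e : R) : C2_objective f -> 0 < e ->
  \forall x \near (0 : 'rV[K]_n),
    `|f x - f 0 - slope f x - 2^-1 * curvature f x| <= e * rnorm x ^+ 2.
Proof.
move=> cf e0; have [d d0 dP] := near_norm (C2_expansion cf e0).
apply/nearE_rnorm; exists d => // x; rewrite subr0 => xd.
have := dP (to_real x); rewrite subr0 => /(_ (le_lt_trans (norm_to_real x) xd)).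
rewrite /= to_realK of_real0 => /le_trans; apply.
by rewrite ler_wpM2l ?(ltW e0) // lerXn2r ?nnegrE ?rnorm_ge0 // norm_to_real.
Qed.

(** The remainder beyond the slope is O(|x|^2), and b_k |x_k|^2 = |b_k x_k| |x_k| tends to 0; hence
    the expansion with the crude constant 1 is enough. *)
Lemma first_order_value f (x : nat -> 'rV[K]_n) (b : nat -> R) v :
  C2_objective f -> x k @[k --> \oo] --> (0 : 'rV[K]_n) -> (forall k, 0 <= b k) ->
  (rcst s (b k) *: x k) @[k --> \oo] --> v ->
  b k * (f (x k) - f 0) @[k --> \oo] --> slope f v.
Proof.
move=> cf x0 b0 /cvg_rnorm bx.
have [S S0 SP] := slope_bounded f; have [C C0 CP] := curvature_bounded f.
have ex := objective_expansion cf (ltr01 : 0 < 1 :> R).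
have exk : \forall k \near \oo,
  `|f (x k) - f 0 - slope f (x k) - 2^-1 * curvature f (x k)| <= 1 * rnorm (x k) ^+ 2 := x0 _ ex.
move/cvg_rnorm0 : x0 => x0.
set D := (1 + C) * (rnorm v + 1).
have D0 : 0 <= D by rewrite mulr_ge0 ?addr_ge0 ?rnorm_ge0.
apply/cvgrPdist_le => e e0.
have c0 : (S * rnorm (rcst s (b k) *: x k - v) + D * rnorm (x k)) @[k --> \oo] --> (0 : R).
  rewrite -[X in _ --> X]addr0 -[X in _ --> X + _](mulr0 S) -[X in _ --> _ + X](mulr0 D).
  by apply: cvgD; apply: cvgM => //; exact: cvg_cst.
near=> k.
have h1 : S * rnorm (rcst s (b k) *: x k - v) + D * rnorm (x k) <= e.
  by near: k; apply: cvgr_le c0 _ e0.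
apply: le_trans h1.
have h2 : rnorm (rcst s (b k) *: x k - v) <= 1 by near: k; apply: cvgr_le bx _ ltr01.
have h3 : `|f (x k) - f 0 - slope f (x k) - 2^-1 * curvature f (x k)| <= 1 * rnorm (x k) ^+ 2.
  by near: k.
have -> : slope f v - b k * (f (x k) - f 0) = - slope f (rcst s (b k) *: x k - v)
   - b k * (f (x k) - f 0 - slope f (x k) - 2^-1 * curvature f (x k))
   - b k * (2^-1 * curvature f (x k)) by rewrite slopeB slopeZ; ring.
apply: le_trans (ler_normB _ _) (le_trans (lerD (ler_normB _ _) (lexx _)) _).
rewrite normrN !normrM (ger0_norm (b0 k)) [`|2^-1|]ger0_norm ?invr_ge0 // -addrA lerD //.
have bxk : b k * rnorm (x k) <= rnorm v + 1.
  have -> : b k * rnorm (x k) = rnorm (rcst s (b k) *: x k).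
    by rewrite rnormZ rabs_rcst ger0_norm.
  by rewrite -(subrK v (rcst s (b k) *: x k)) addrC (le_trans (rnormD _ _)) // lerD.
apply: (@le_trans _ _ (b k * rnorm (x k) * ((1 + C) * rnorm (x k)))).
  have -> : b k * rnorm (x k) * ((1 + C) * rnorm (x k))
     = b k * (1 * rnorm (x k) ^+ 2) + b k * (C * rnorm (x k) ^+ 2) by ring.
  rewrite lerD // ?ler_wpM2l //.
  by have := CP (x k); have := normr_ge0 (curvature f (x k)); lra.
rewrite /D mulrCA -mulrA ler_wpM2l ?addr_ge0 // ler_wpM2r ?rnorm_ge0 //.
Unshelve. all: by end_near. Qed.

(** The w_k are only bounded, so the quotient is compared with the slope at w_k instead of having a
    limit. With zero remainder this serves the necessary condition, with the o(t^2) of parabolic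
    regularity the sufficient one; slope f u = 0 removes the term of order 1/t. *)
Lemma second_order_value f u (x : nat -> 'rV[K]_n) (t : nat -> R) (w : nat -> 'rV[K]_n) (B : R) :
  C2_objective f -> (forall k, 0 < t k) -> t k @[k --> \oo] --> (0 : R) -> 0 <= B ->
  (\forall k \near \oo, rnorm (w k) <= B) ->
  ((rcst s (t k) ^+ 2)^-1 *:
     (x k - (rcst s (t k) *: u + (2^-1 * rcst s (t k) ^+ 2) *: w k))) @[k --> \oo]
     --> (0 : 'rV[K]_n) ->
  (rcst s (t k)^-1 *: x k @[k --> \oo] --> u) /\
  (slope f u = 0 ->
   (2 * (t k ^+ 2)^-1 * (f (x k) - f 0) - (curvature f u + slope f (w k))) @[k --> \oo] --> (0 : R)).
Proof.
move=> cf tp t0 B0 wB /cvg_rnorm0 r0.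
have half : 2^-1 = rcst s 2^-1 :> K by rewrite rcstV -(rcst_nat R s 2).
have two : 2 = rcst s 2 :> K by rewrite -(rcst_nat R s 2).
set r := fun k => (rcst s (t k) ^+ 2)^-1 *:
     (x k - (rcst s (t k) *: u + (2^-1 * rcst s (t k) ^+ 2) *: w k)).
rewrite -/r in r0.
(* The remainder is absorbed into z, with a factor 2 for the 1/2 of the parabola, so that x = t (u +
   t/2 z) exactly while z stays bounded. *)
pose z k := w k + rcst s 2 *: r k.
pose y k := u + rcst s (2^-1 * t k) *: z k.
have tK k : rcst s (t k) != 0 by rewrite rcst_eq0 gt_eqF.
have xy k : x k = rcst s (t k) *: y k.
  rewrite /y /z /r scalerDr !scalerA.
  have -> : rcst s (t k) * rcst s (2^-1 * t k) = 2^-1 * rcst s (t k) ^+ 2.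
    by rewrite rcstM -half; ring.
  rewrite scalerDr addrA !scalerA.
  have -> : 2^-1 * rcst s (t k) ^+ 2 * (rcst s 2 * (rcst s (t k) ^+ 2)^-1) = 1.
    by rewrite -two mulrACA mulVf // mulfV ?expf_neq0 // mul1r.
  by rewrite scale1r addrC subrK.
have yE k : rcst s (t k)^-1 *: x k = y k by rewrite xy scalerA rcstV mulVf // scale1r.
have zB : \forall k \near \oo, rnorm (z k) <= B + 2.
  near=> k; apply: le_trans (rnormD _ _) _; rewrite lerD //; first by near: k.
  rewrite rnormZ rabs_rcst ger0_norm //.
  have : rnorm (r k) <= 1 by near: k; apply: cvgr_le r0 _ ltr01.
  by lra.
have yu : rnorm (y k - u) @[k --> \oo] --> (0 : R).
  apply: (squeeze_cvgr _ (@cvg_cst _ (0 : R) _ _ _) (h := fun k => (B + 2) * t k)).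
    near=> k; rewrite rnorm_ge0 /y addrC addKr rnormZ rabs_rcst.
    have zk : rnorm (z k) <= B + 2 by near: k.
    rewrite ger0_norm ?mulr_ge0 ?(ltW (tp k)) // mulrC ler_pM ?rnorm_ge0 ?mulr_ge0 ?(ltW (tp k)) //.
    by have := tp k; lra.
  by rewrite -[X in _ --> X](mulr0 (B + 2)); apply: cvgM => //; exact: cvg_cst.
split=> [|su]; first by apply/cvg_rnorm; under eq_fun do rewrite yE.
have x0 : x k @[k --> \oo] --> (0 : 'rV[K]_n).
  under eq_fun do rewrite xy; rewrite -(scale0r u); apply: cvgZ; last by apply/cvg_rnorm.
  by apply/cvg_rabs; under eq_fun do rewrite subr0 rabs_rcst gtr0_norm //.
have [S S0 SP] := slope_bounded f; have [C C0 CP] := curvature_lipschitz f.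
set U := rnorm u + 1.
have U0 : 0 < U by rewrite ltr_wpDl // rnorm_ge0.
apply/cvgrPdist_le => e e0.
(* Chosen so that 2 e' U^2 = e / 2 once |y_k| <= U. *)
set e' := e / (4 * U ^+ 2).
have e'0 : 0 < e' by rewrite divr_gt0 // mulr_gt0 // exprn_gt0.
have ex := objective_expansion cf e'0.
have exk : \forall k \near \oo,
  `|f (x k) - f 0 - slope f (x k) - 2^-1 * curvature f (x k)| <= e' * rnorm (x k) ^+ 2 := x0 _ ex.
have c0 : (S * (2 * rnorm (r k)) + C * (2 * U) * rnorm (y k - u)) @[k --> \oo] --> (0 : R).
  have -> : (0 : R) = S * (2 * 0) + C * (2 * U) * 0 by ring.
  by apply: cvgD; apply: cvgM; try exact: cvg_cst; rewrite //; apply: cvgM => //; exact: cvg_cst.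
near=> k.
rewrite sub0r normrN.
have h1 : S * (2 * rnorm (r k)) + C * (2 * U) * rnorm (y k - u) <= e / 2.
  by near: k; apply: cvgr_le c0 _ _; rewrite divr_gt0.
have h2 : rnorm (y k - u) <= 1 by near: k; apply: cvgr_le yu _ ltr01.
have h3 : `|f (x k) - f 0 - slope f (x k) - 2^-1 * curvature f (x k)| <= e' * rnorm (x k) ^+ 2.
  by near: k.
have tk0 : t k != 0 by rewrite gt_eqF.
have sx : slope f (x k) = 2^-1 * t k ^+ 2 * slope f (w k) + t k ^+ 2 * slope f (r k).
  by rewrite xy slopeZ /y slopeD su add0r slopeZ /z slopeD slopeZ; field.
have cx : curvature f (x k) = t k ^+ 2 * curvature f (y k) by rewrite xy curvatureZ.
have yU : rnorm (y k) <= U.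
  by rewrite -(subrK u (y k)) addrC (le_trans (rnormD _ _)) // lerD.
have -> : 2 * (t k ^+ 2)^-1 * (f (x k) - f 0) - (curvature f u + slope f (w k)) =
  2 * (t k ^+ 2)^-1 * (f (x k) - f 0 - slope f (x k) - 2^-1 * curvature f (x k))
  + (2 * slope f (r k) + (curvature f (y k) - curvature f u)).
  by rewrite cx sx; field.
apply: le_trans (ler_normD _ _) _.
have -> : e = e / 2 + e / 2 by field.
apply: lerD.
  rewrite normrM ger0_norm ?mulr_ge0 ?invr_ge0 ?exprn_ge0 ?(ltW (tp k)) //.
  apply: le_trans (ler_wpM2l _ h3) _.
    by rewrite ?mulr_ge0 ?invr_ge0 ?exprn_ge0 ?(ltW (tp k)).
  rewrite xy rnormZ rabs_rcst gtr0_norm //.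
  have -> : 2 * (t k ^+ 2)^-1 * (e' * (t k * rnorm (y k)) ^+ 2) = 2 * e' * rnorm (y k) ^+ 2.
    by field.
  apply: (@le_trans _ _ (2 * e' * U ^+ 2)).
    apply: ler_wpM2l; first by rewrite mulr_ge0 // ltW.
    by rewrite lerXn2r // nnegrE ?rnorm_ge0 // ltW.
  have -> : 2 * e' * U ^+ 2 = e / 2 by rewrite /e'; field; rewrite gt_eqF.
  exact: lexx.
apply: le_trans (ler_normD _ _) (le_trans _ h1).
rewrite lerD //.
  by rewrite normrM ger0_norm // mulrCA ler_wpM2l.
apply: le_trans (CP _ _) _; rewrite ler_wpM2r ?rnorm_ge0 // ler_wpM2l //.
by have : rnorm u <= U; rewrite /U ?lerDl //; move: yU; rewrite /U; lra.
Unshelve. all: by end_near. Qed.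

Lemma enorm_ge0 x : 0 <= enorm x. Proof. exact: sqrtr_ge0. Qed.

Lemma enorm_sqr x : enorm x ^+ 2 = \sum_i to_real x 0 i ^+ 2.
Proof. by rewrite sqr_sqrtr // sumr_ge0 // => i _; exact: sqr_ge0. Qed.

Lemma enorm_le x : enorm x ^+ 2 <= (real_dim s n)%:R * rnorm x ^+ 2.
Proof.
rewrite enorm_sqr mulr_natl -[X in _ *+ X](card_ord (real_dim s n)) -sumr_const.
apply: ler_sum => i _; rewrite -real_normK ?num_real // lerXn2r ?nnegrE ?rnorm_ge0 //.
by rewrite (le_trans (norm_coord _ _)) // norm_to_real.
Qed.

Lemma rnorm_le_enorm x : rnorm x <= 2 * enorm x.
Proof.
rewrite -{1}(to_realK x); apply: le_trans (rnorm_of_real _) _; rewrite ler_wpM2l //.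
apply: norm_row_le => [|i]; first exact: enorm_ge0.
rewrite -sqrtr_sqr; apply: ler_wsqrtr; rewrite (bigD1 i) //= lerDl sumr_ge0 // => j _.
exact: sqr_ge0.
Qed.

Lemma enorm_gt0 x : x != 0 -> 0 < enorm x.
Proof. by rewrite -rnorm_gt0; have := rnorm_le_enorm x; lra. Qed.

Lemma of_real_continuous : continuous (@of_real R s n).
Proof.
move=> y A /nearE_rnorm [e e0 eA]; apply/(nearE_rnorm (s := RealScalars)).
exists (e / 2); first by rewrite divr_gt0.
move=> x; rewrite rnorm_real => xy; apply: eA; rewrite -of_realB.
by have := rnorm_of_real (x - y : 'rV[R]_(real_dim s n)); lra.
Qed.

(** Closed balls are compact in real coordinates, and continuity of [of_real] carries the cluster
    point back. *)
Lemma bounded_cluster (w : nat -> 'rV[K]_n) (B : R) : (forall k, rnorm (w k) <= B) ->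
  exists v, cluster (w k @[k --> \oo]) v.
Proof.
move=> wB.
have cB : compact [set y : 'rV[R]_(real_dim s n) | `|y| <= B].
  apply: bounded_closed_compact.
    by exists B; split; [exact: num_real|move=> x Bx y /= yB; exact: ltW (le_lt_trans yB Bx)].
  apply: (@closed_comp _ _ (fun y : 'rV[R]_(real_dim s n) => `|y|) [set x | x <= B]).
    by move=> y _; exact: norm_continuous.
  exact: closed_le.
have wB' : \forall k \near \oo, `|to_real (w k)| <= B.
  by apply: nearW => k; exact: le_trans (norm_to_real _) (wB k).
have [p [_ pc]] := cB (to_real (w k) @[k --> \oo]) _ wB'.
exists (of_real p) => A A' wA nA'.
have nB : nbhs p (@of_real R s n @^-1` A') := of_real_continuous nA'.
have wA2 : (to_real (w k) @[k --> \oo]) (@of_real R s n @^-1` A).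
  have wA3 : \forall k \near \oo, A (w k) := wA.
  have : \forall k \near \oo, A (of_real (to_real (w k)))
    by apply: filterS wA3 => k; rewrite to_realK.
  exact.
by have [q [qA qA']] := pc _ _ wA2 nB; exists (of_real q).
Qed.
End Objective.

(** * Homogeneous cones *)

Section Cones.
Variables (R : realType) (s : scalar_kind) (n : nat).
Notation K := (scalars R s).
Notation poly := (mpoly.mpoly n K).
Implicit Types (X : set 'rV[K]_n) (f : 'rV[K]_n -> R) (a b u v w x y : 'rV[K]_n).

(** A real-linear form on C^n is the real part of a unique C-linear one, and is controlled by it;
    conversely the imaginary part at v is recovered from the slope at -i v. This makes the slope
    testable by an analytic germ. *)
Lemma slope_linear_form f : exists a, (forall v, pairing a v = 0 -> slope f v = 0) /\
  forall v, (forall c : K, slope f (c *: v) = 0) -> pairing a v = 0.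
Proof.
case: s f => f.
  exists (gradient (f \o @of_real R RealScalars n) 0); split=> // v /(_ 1).
  by rewrite scale1r.
set G := gradient (f \o @of_real R ComplexScalars n) 0.
(* The sign comes from Re((p - i q)(x + i y)) = p x + q y. *)
pose a : 'rV[R[i]]_n := \row_j Complex (G 0 (lshift n j)) (- G 0 (rshift n j)).
have ReE (v : 'rV[scalars R ComplexScalars]_n) : complex.Re (pairing a v) = slope f v.
  rewrite /pairing (big_morph (@complex.Re R) (id1 := 0) (op1 := +%R)) //; last first.
    by move=> [? ?] [? ?].
  rewrite /slope /= -/G /pairing big_split_ord /= -big_split /=; apply: eq_bigr => j _.
  by rewrite row_mxEl row_mxEr !mxE; case: (v 0 j) => x y /=; rewrite mulNr opprK.
exists a; split=> [v av|v sv]; first by rewrite -ReE av.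
have sv1 : slope f v = 0 by rewrite -[v]scale1r.
apply/eqP; rewrite eq_complex ReE sv1 eqxx /=.
have := sv (Complex 0 (-1)); rewrite -ReE (@pairingZr R ComplexScalars).
by case: (pairing a v) => p q /=; rewrite mul0r sub0r mulN1r opprK => ->.
Qed.

(** An expansion at every b is wanted because [analytic_germ] asks for analyticity around 0 and not
    only at 0. At b = 0 a nonzero form has order one, and its vanishing quadratic part reduces the
    equation of T^{2,a} to [pairing a w = 0]. *)
Lemma linear_form_power_series a b : exists p,
  [/\ power_series_at (pairing a) b p, p 0%N = mpoly.mpolyC n (pairing a b),
      forall u, pgrad (p 1%N) u = a & p 2%N = 0].
Proof.
pose ell : poly := \sum_i mpoly.mpolyC n (a 0 i) * mpoly.mpolyX K (mpoly.mnm1 i).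
have ellE x : peval ell x = pairing a x.
  rewrite /ell (big_morph (fun q => peval q x) (id1 := 0) (op1 := +%R)).
  - by apply: eq_bigr => i _; rewrite pevalM pevalC pevalXU.
  - by move=> q q'; rewrite pevalD.
  - by rewrite peval0.
pose p j : poly := if j == 0%N then mpoly.mpolyC n (pairing a b) else if j == 1%N then ell else 0.
exists p; split=> //; last first.
  move=> u; rewrite /p /= /ell (big_morph (fun q => pgrad q u) (id1 := 0) (op1 := +%R)).
  - apply/rowP => i; rewrite summxE (bigD1 i) //= big1 ?addr0 => [|j ji].
      by rewrite pgradM pgradC pgradXU scaler0 add0r pevalC !mxE !eqxx mulr1.
    by rewrite pgradM pgradC pgradXU scaler0 add0r !mxE eq_sym (negbTE ji) andbF mulr0.
  - by move=> q q'; rewrite pgradD.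
  - by rewrite -mpoly.mpolyC0 pgradC.
have p0 j : (1 < j)%N -> p j = 0 by case: j => [|[|j]].
split.
  case=> [|[|j]]; rewrite /p /=.
  - by rewrite -[mpoly.mpolyC _ _]mulr1 mpoly.mul_mpolyC mpoly.dhomogZ // mpoly.dhomog1.
  - apply: (big_ind (fun q => q \is mpoly.ishomog1 1 mpoly.mdeg)).
    + exact: mpoly.dhomog0.
    + by move=> q q' hq hq'; exact: mpoly.dhomogD.
    + move=> i _; rewrite mpoly.mul_mpolyC mpoly.dhomogZ // mpoly.dhomogX.
      by apply/eqP; exact: mpoly.mdeg1.
  - exact: mpoly.dhomog0.
exists 1; split=> //.
  pose F j : K := \sum_(m <- mpoly.msupp (p j)) `|mpoly.mcoeff m (p j)| * 1 ^+ j.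
  exists (F 0%N + F 1%N) => N.
  have F0 j : 0 <= F j by apply: sumr_ge0 => m _; rewrite expr1n mulr1.
  apply: (@le_trans _ _ (\sum_(j < N.+2) F j)).
    by rewrite !big_ord_recr /= -addrA lerDl addr_ge0.
  rewrite 2!big_ord_recl /= [X in _ + (_ + X)]big1 ?addr0 // => j _.
  by rewrite /F p0 // mpoly.msupp0 big_nil.
move=> y _; apply: cvg_near_cst; exists 2%N => // N /= N2.
rewrite -(subnK N2) addnC 2!big_ord_recl /= big1 => [|j _].
  by rewrite /p /= pevalC ellE addr0 pairingDr.
by rewrite p0 // peval0.
Qed.

Lemma homogeneous_scale d (h : 'rV[K]_n -> K) (c : K) x : homogeneous d h ->
  h x = 0 -> h (c *: x) = 0.
Proof. by move=> hh hx; rewrite hh hx mulr0. Qed.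

Lemma homogeneous_cone_slope X f u : homogeneous_cone X -> tangent_cone X u ->
  (forall v, tangent_cone X v -> 0 <= slope f v) ->
  tangent2 X u 0 /\ forall w, tangent2_alg X u w -> slope f w = 0.
Proof.
move=> [q [h [hP XP]]] Tu slope_ge0.
pose Z := [set x | forall i, h i x = 0].
have Zs (c : K) x : Z x -> Z (c *: x).
  move=> Zx i; have [_ [d hd]] := hP i; exact: homogeneous_scale hd (Zx i).
have [e e0 eP] := (nearE_rnorm _ _).1 XP.
have ZX x : rnorm x < e -> X x <-> Z x by move=> xe; apply: eP; rewrite subr0.
have TZ : Z u.
  move: Tu => [x [t [Xx tp x0 txu]]] i.
  have [/nearE_rnorm [e' e'0 ha] [d hd]] := hP i.
  (* u may lie outside the neighbourhood where h_i is analytic, so it is first shrunk to c u;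
     homogeneity carries the zero back to u. *)
  have [c c0 cu] : exists2 c : R, 0 < c & rnorm (rcst s c *: u) < e'.
    exists (e' / (rnorm u + 1)); first by rewrite divr_gt0 // ltr_wpDl ?rnorm_ge0.
    have u0 : 0 < rnorm u + 1 by rewrite ltr_wpDl ?rnorm_ge0.
    rewrite rnormZ rabs_rcst ger0_norm ?divr_ge0 ?ltW //.
    by rewrite mulrAC ltr_pdivrMr // ltr_pM2l // ltrDl.
  suff hcu : h i (rcst s c *: u) = 0.
    have -> : u = (rcst s c)^-1 *: (rcst s c *: u).
      by rewrite scalerA mulVf ?scale1r // rcst_eq0 gt_eqF.
    exact: homogeneous_scale hd hcu.
  have an : analytic_at (h i) (rcst s c *: u) by apply: ha; rewrite subr0.
  have [C C0 CP] := analytic_lipschitz an.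
  near (0 : R)^'+ => r.
  have r0 : 0 < r by near: r; exact: nbhs_right_gt.
  have Cr : forall x y, rnorm (x - rcst s c *: u) <= r -> rnorm (y - rcst s c *: u) <= r ->
      rabs (h i x - h i y) <= C * rnorm (x - y) by near: r.
  pose y k := rcst s c *: (t k *: x k).
  have yu : rnorm (y k - rcst s c *: u) @[k --> \oo] --> (0 : R).
    by apply/cvg_rnorm; apply: cvgZ => //; exact: cvg_cst.
  have xZ : \forall k \near \oo, X (x k) <-> Z (x k) := x0 _ XP.
  apply/eqP; rewrite -rabs_eq0 eq_le rabs_ge0 andbT.
  apply: (@cvgr_to_ge _ \oo _ _ (fun k => C * rnorm (y k - rcst s c *: u))).
    by rewrite -[X in _ --> X](mulr0 C); apply: cvgM => //; exact: cvg_cst.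
  near=> k.
  have Zx : Z (x k) by apply/(_ : X (x k) <-> Z (x k)); [near: k|case: (Xx k)].
  have hy : h i (y k) = 0 by apply: (Zs (rcst s c)); exact: Zs.
  rewrite -rabsN -[- h i _]add0r -{1}hy; apply: Cr; last by rewrite subrr rnorm0 ltW.
  by near: k; apply: cvgr_le yu _ r0.
have ZT v : Z v -> v != 0 -> tangent_cone X v.
  move=> Zv v0.
  have nv0 : 0 < rnorm v by rewrite rnorm_gt0.
  pose b k : R := e / (2 * rnorm v) * harmonic k.
  have h0 k : 0 < (harmonic k : R) by rewrite /harmonic invr_gt0.
  have b0 k : 0 < b k by rewrite mulr_gt0 // divr_gt0 // mulr_gt0.
  have h1 k : (harmonic k : R) <= 1 by rewrite /harmonic invf_le1 // ler1n.
  have be k : rnorm (rcst s (b k) *: v) < e.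
    rewrite rnormZ rabs_rcst gtr0_norm //.
    have -> : b k * rnorm v = e / 2 * harmonic k by rewrite /b; field; rewrite gt_eqF.
    apply: (@le_lt_trans _ _ (e / 2)); first by rewrite ler_piMr // divr_ge0 // ltW.
    by rewrite ltr_pdivrMr // ltr_pMr // ltr1n.
  have bc : b k @[k --> \oo] --> (0 : R).
    rewrite -[X in _ --> X](mulr0 (e / (2 * rnorm v))).
    by apply: cvgM; [exact: cvg_cst|exact: cvg_harmonic].
  have bK k : rcst s (b k) != 0 by rewrite rcst_eq0 gt_eqF.
  exists (fun k => rcst s (b k) *: v), (fun k => (rcst s (b k))^-1); split.
  - by move=> k; split; [apply/ZX => //; exact: Zs|rewrite scaler_eq0 negb_or bK].
  - by move=> k; rewrite invr_gt0 -(rcst0 R s) rcst_lt.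
  - rewrite -(scale0r v); apply: cvgZ; last exact: cvg_cst.
    apply/cvg_rabs; under eq_fun do rewrite subr0 rabs_rcst gtr0_norm //.
    exact: bc.
  - under eq_fun do rewrite scalerA mulVf // scale1r.
    exact: cvg_cst.
(* Z is stable under -1, so the slope is nonnegative at both v and -v. *)
have slope0 v : Z v -> slope f v = 0.
  have sZ z : Z z -> 0 <= slope f z.
    move=> Zz; have [->|z0] := eqVneq z 0; last exact: slope_ge0 (ZT _ Zz z0).
    by rewrite slope_at0.
  move=> Zv; apply/eqP; rewrite eq_le sZ // andbT -oppr_ge0 -mulN1r -slopeZ.
  by apply: (sZ); exact: Zs.
split.
  (* The ray t u itself lies in X near 0, so the constant choice w' = 0 works. *)
  apply: (@tangent2_intro _ _ _ _ _ _ 0).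
  have := parabola_small u (lexx 0) e0; apply: filterS => t /(_ 0).
  rewrite rnorm0 scaler0 addr0 => /(_ (lexx _)) te; exists 0; first by rewrite subrr rnorm0 mul0r.
  by rewrite scaler0 addr0; apply/ZX => //; exact: Zs.
have [a [a1 a2]] := slope_linear_form f.
move=> w wE; apply: a1.
have aZ v : Z v -> pairing a v = 0 by move=> Zv; apply: a2 => c; apply: slope0; exact: Zs.
(* T^{2,a} is tested by nonzero germs only, so the zero form is set apart. *)
have [-> |a0] := eqVneq a 0; first by rewrite -(scale0r (0 : 'rV[K]_n)) pairingZl mul0r.
have [p [pp p0 p1 p2]] := linear_form_power_series a 0.
have vg : vanishing_germ X (pairing a).
  split; first by near=> b; have [r [rr _ _ _]] := linear_form_power_series a b; exists r.
  by apply: filterS XP => x XZ /XZ; exact: aZ.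
have ig : initial_degree (pairing a) p 1.
  split=> // [|[|//] _]; last by rewrite p0 pairing0r mpoly.mpolyC0.
  by apply: contra_neq a0 => p10; rewrite -(p1 0) p10 -mpoly.mpolyC0 pgradC.
have := wE _ _ _ vg ig; rewrite p1 p2 peval0 addr0 => /eqP.
by rewrite mulf_eq0 invr_eq0 pnatr_eq0 /= => /eqP.
Unshelve. all: by end_near. Qed.
End Cones.

(** * Second-order conditions *)

Section Conditions.
Variables (R : realType) (s : scalar_kind) (n : nat).
Notation K := (scalars R s).
Implicit Types (X : set 'rV[K]_n) (f : 'rV[K]_n -> R) (u v w x : 'rV[K]_n).

(** Equality of slopes, in place of w' = w, is all that the infima see and all that a cone allows;
    there the witness is always w' = 0. *)
Lemma admissible_tangent2 X f u w : X 0 -> tangent_cone X u -> admissible X u ->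
  (forall v, tangent_cone X v -> 0 <= slope f v) -> tangent2_alg X u w ->
  exists2 w', tangent2 X u w' & slope f w' = slope f w.
Proof.
move=> X0 Tu [smooth|cone|[g [p [m [ag gX gp pu]]]]|[q [d [g [p [m [_ [vg _] gX gp rk]]]]]]] sl wE.
- by exists w => //; exact: smooth_tangent2.
- by have [T0 wf] := homogeneous_cone_slope cone Tu sl; exists 0; rewrite ?slope_at0 ?wf.
(* A hypersurface is the case q = 1 of the criterion for several equations, rank 1 meaning that the
   gradient is nonzero. *)
- have vg : vanishing_germ X g by split=> //; apply: filterS gX => x [].
  exists w => //; apply: (nondegenerate_tangent2
    (q := 1) (g := fun=> g) (p := fun=> p) (m := fun=> m)).
  + by move=> _.
  + by move=> _; exact: tangent_cone_initial_form Tu vg gp.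
  + have -> : \matrix_(i < 1) pgrad (p m) u = pgrad (p m) u.
      by apply/rowP => j; rewrite mxE.
    by rewrite rank_rV pu.
  + apply: filterS gX => x gx; split=> [/gx //|/(_ ord0) /gx //].
  + by move=> _; exact: wE vg gp.
- exists w => //; apply: (nondegenerate_tangent2 gp _ rk gX).
  + by move=> i; exact: tangent_cone_initial_form Tu (vg i) (gp i).
  + by move=> i; exact: wE (vg i) (gp i).
Qed.

Lemma local_minimizer_slope X f v : C2_objective f -> local_minimizer0 X f ->
  tangent_cone X v -> 0 <= slope f v.
Proof.
move=> cf fmin [x [t [Xx tp x0 tx]]].
have tE k : t k = rcst s (rabs (t k)) by rewrite -norm_rabs gtr0_norm.
have tx' : (rcst s (rabs (t k)) *: x k) @[k --> \oo] --> v by under eq_fun do rewrite -tE.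
have fv := first_order_value cf x0 (fun k => rabs_ge0 (t k)) tx'.
have fx : \forall k \near \oo, X (x k) -> f 0 <= f (x k) := x0 _ fmin.
apply: (cvgr_to_ge fv); apply: filterS fx => k fx.
by rewrite mulr_ge0 ?rabs_ge0 // subr_ge0 fx //; case: (Xx k).
Qed.

Lemma local_minimizer_second_order X f u w : C2_objective f -> local_minimizer0 X f ->
  slope f u = 0 -> tangent2 X u w -> 0 <= curvature f u + slope f w.
Proof.
move=> cf fmin su [t [w_ [td ww Xx]]].
have [x0 _] := parabola_cvg u td ww.
have [tau [tE tp tau0]] := decreases_to_0_real td.
pose x k := t k *: u + (2^-1 * t k ^+ 2) *: w_ k.
have fx : \forall k \near \oo, X (x k) -> f 0 <= f (x k) := x0 _ fmin.
move/cvg_rnorm : ww => ww.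
have B0 : 0 <= rnorm w + 1 by rewrite addr_ge0 ?rnorm_ge0.
have wB : \forall k \near \oo, rnorm (w_ k) <= rnorm w + 1.
  near=> k; rewrite -(subrK w (w_ k)) addrC (le_trans (rnormD _ _)) // lerD //.
  by near: k; apply: cvgr_le ww _ ltr01.
have r0 : ((rcst s (tau k) ^+ 2)^-1 *:
     (x k - (rcst s (tau k) *: u + (2^-1 * rcst s (tau k) ^+ 2) *: w_ k))) @[k --> \oo]
     --> (0 : 'rV[K]_n).
  have xE k : x k = rcst s (tau k) *: u + (2^-1 * rcst s (tau k) ^+ 2) *: w_ k by rewrite /x tE.
  under eq_fun do rewrite xE subrr scaler0.
  exact: cvg_cst.
have [_ /(_ su) D0] := second_order_value cf tp tau0 B0 wB r0.
have [S S0 SP] := slope_bounded f.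
have c0 : ((2 * (tau k ^+ 2)^-1 * (f (x k) - f 0) - (curvature f u + slope f (w_ k)))
    + S * rnorm (w_ k - w)) @[k --> \oo] --> (0 : R).
  have -> : (0 : R) = 0 + S * 0 by ring.
  by apply: cvgD => //; apply: cvgM => //; exact: cvg_cst.
rewrite -oppr_le0; apply: (cvgr_to_ge c0).
near=> k.
have fk : f 0 <= f (x k).
  have fxk : X (x k) -> f 0 <= f (x k) by near: k; exact: fx.
  exact: fxk (Xx k).
have : 0 <= 2 * (tau k ^+ 2)^-1 * (f (x k) - f 0).
  by rewrite mulr_ge0 ?subr_ge0 // mulr_ge0 // invr_ge0 exprn_ge0 // ltW.
have := SP (w_ k - w); rewrite slopeB ler_norml => /andP[_].
by lra.
Unshelve. all: by end_near. Qed.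

(** Points that violate growth satisfy f(x) - f(0) <= o(|x|^2). Written as parabolas by the
    regularity hypothesis, they yield a critical u and a cluster point of the w_k, lying in T^2, at
    which the second-order value would be at most 0. *)
Lemma second_order_growth X f : X 0 -> C2_objective f -> parabolic_regularity X f ->
  (forall u, tangent_cone X u -> 0 <= slope f u) ->
  (forall u w, critical X f u -> tangent2 X u w -> 0 < curvature f u + slope f w) ->
  quadratic_growth0 X f.
Proof.
move=> X0 cf preg sl0 pos; apply: contrapT => ngrowth.
(* c k serves both as radius and as growth constant, so the failure of growth yields x_k -> 0 whose
   difference quotient is below c k <= 1. *)
pose c k : R := harmonic k.
have c0 k : 0 < c k by rewrite /c /harmonic invr_gt0.
have c1 k : c k <= 1 by rewrite /c /harmonic invf_le1 // ler1n.
have ex k : exists x, [/\ X x, enorm x < c k & f x < f 0 + c k * enorm x ^+ 2].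
  apply: contrapT => nx; apply: ngrowth; exists (c k), (c k); split=> // x Xx xk.
  by rewrite leNgt; apply/negP => fx; apply: nx; exists x.
have [x xP] := choice ex.
have x0 : x k @[k --> \oo] --> (0 : 'rV[K]_n).
  apply/cvg_rnorm0; apply: (squeeze_cvgr _ (@cvg_cst _ (0 : R) _ _ _) (h := fun k => 2 * c k)).
    apply: nearW => k; rewrite rnorm_ge0 (le_trans (rnorm_le_enorm _)) // ler_wpM2l //.
    by case: (xP k) => _ /ltW.
  by rewrite -[X in _ --> X](mulr0 2); apply: cvgM; [exact: cvg_cst|exact: cvg_harmonic].
have Xx k : X (x k) /\ x k != 0.
  have [Xk _ fk] := xP k; split=> //; apply/eqP => xk; move: fk.
  rewrite xk enorm_sqr big1 ?mulr0 ?addr0 ?ltxx // => i _.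
  by rewrite to_real0 mxE expr0n.
have [|sub [u [t [w [sub_mono [Tu u0] td [M wM] [r0 clu]]]]]] := preg x Xx x0.
  exists 1 => k; have [_ _ fk] := xP k; have [_ xk] := Xx k.
  have en : 0 < enorm (x k) ^+ 2 by rewrite exprn_gt0 // enorm_gt0.
  rewrite ler_pdivrMr // mul1r lerBlDl (le_trans (ltW fk)) // lerD2l.
  by rewrite ler_piMl // ltW.
have subk k : (k <= sub k)%N.
  by elim: k => // k IH; exact: leq_ltn_trans IH (sub_mono _ _ (ltnSn k)).
have csub : c (sub k) @[k --> \oo] --> (0 : R).
  apply: (squeeze_cvgr _ (@cvg_cst _ (0 : R) _ _ _) (h := c)); last exact: cvg_harmonic.
  apply: nearW => k; rewrite ltW //= /c /harmonic lef_pV2 ?posrE // ler_nat ltnS.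
  exact: subk.
have xs0 : x (sub k) @[k --> \oo] --> (0 : 'rV[K]_n).
  apply/cvg_rnorm0; apply: (squeeze_cvgr _ (@cvg_cst _ (0 : R) _ _ _)
    (h := fun k => 2 * c (sub k))).
    apply: nearW => k; rewrite rnorm_ge0 (le_trans (rnorm_le_enorm _)) // ler_wpM2l //.
    by case: (xP (sub k)) => _ /ltW.
  by rewrite -[X in _ --> X](mulr0 2); apply: cvgM => //; exact: cvg_cst.
have [tau [tE tp tau0]] := decreases_to_0_real td.
have wB k : rnorm (w k) <= rabs M.
  rewrite -(@rcst_le _ s) -norm_rnorm -norm_rabs ger0_norm //.
  exact: le_trans (normr_ge0 (w 0%N)) (wM 0%N).
rewrite tE /= in r0.
have [S S0 SP] := slope_bounded f.
set E := (real_dim s n)%:R : R.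
have [yu D0] := second_order_value cf tp tau0 (rabs_ge0 M) (nearW _ wB) r0.
pose y k := rcst s (tau k)^-1 *: x (sub k).
have fub k : f (x (sub k)) - f 0 <= c (sub k) * (E * rnorm (x (sub k)) ^+ 2).
  have [_ _ fk] := xP (sub k); rewrite lerBlDl (le_trans (ltW fk)) // lerD2l.
  by rewrite ler_wpM2l ?enorm_le // ltW.
have xy k : rnorm (x (sub k)) = tau k * rnorm (y k).
  rewrite /y rnormZ rabs_rcst gtr0_norm ?invr_gt0 // mulrA mulfV ?mul1r //.
  by rewrite gt_eqF.
set U := rnorm u + 1.
have yU : \forall k \near \oo, rnorm (y k) <= U.
  move/cvg_rnorm : yu => yu; near=> k.
  rewrite -(subrK u (y k)) addrC (le_trans (rnormD _ _)) // lerD //.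
  by near: k; apply: cvgr_le yu _ ltr01.
have yEU k : rnorm (y k) <= U -> f (x (sub k)) - f 0 <= tau k ^+ 2 * (E * U ^+ 2 * c (sub k)).
  move=> yUk; apply: le_trans (fub k) _; rewrite xy.
  have -> : c (sub k) * (E * (tau k * rnorm (y k)) ^+ 2) =
    tau k ^+ 2 * (E * rnorm (y k) ^+ 2 * c (sub k)) by ring.
  rewrite ler_wpM2l ?exprn_ge0 ?(ltW (tp k)) // ler_wpM2r ?(ltW (c0 _)) // ler_wpM2l //.
  by rewrite lerXn2r // nnegrE ?rnorm_ge0 // (le_trans (rnorm_ge0 _) yUk).
(* Here f(x) - f(0) <= O(t^2), so its quotient by t, which tends to the slope at u, has a limit at
   most 0. *)
have su : slope f u = 0.
  apply/eqP; rewrite eq_le sl0 // andbT.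
  have b0 k : 0 <= (tau k)^-1 by rewrite invr_ge0 ltW.
  have fv := first_order_value cf xs0 b0 yu.
  have h0 : E * U ^+ 2 * tau k @[k --> \oo] --> (0 : R).
    by rewrite -[X in _ --> X](mulr0 (E * U ^+ 2)); apply: cvgM => //; exact: cvg_cst.
  apply: (ler_cvg_to fv h0); near=> k.
  have yUk : rnorm (y k) <= U by near: k.
  rewrite ler_pdivrMl //; apply: le_trans (yEU k yUk) _.
  have -> : tau k * (E * U ^+ 2 * tau k) = tau k ^+ 2 * (E * U ^+ 2 * 1) by ring.
  apply: ler_wpM2l; first exact: sqr_ge0.
  by apply: ler_wpM2l => //; rewrite mulr_ge0 // sqr_ge0.
have {}D0 := D0 su.
have [v cv] := bounded_cluster wB.
have := pos u v (And3 Tu u0 su) (clu _ cv).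
set T := curvature f u + slope f v => T0.
have g0 : (2 * (E * U ^+ 2 * c (sub k)) - (2 * (tau k ^+ 2)^-1 * (f (x (sub k)) - f 0)
    - (curvature f u + slope f (w k)))) @[k --> \oo] --> (0 : R).
  have -> : (0 : R) = 2 * (E * U ^+ 2 * 0) - 0 by ring.
  apply: cvgB => //; apply: cvgM; first exact: cvg_cst.
  by apply: cvgM => //; exact: cvg_cst.
(* Some w_k close to v has second-order value at most T / 3, and moving to v costs at most another T
   / 3; then T <= 2 T / 3, against T > 0. *)
have T3 : 0 < T / 3 by rewrite divr_gt0.
have near_w : \forall k \near \oo, curvature f u + slope f (w k) <= T / 3.
  near=> k.
  have yUk : rnorm (y k) <= U by near: k.
  apply: le_trans (_ : _ <= 2 * (E * U ^+ 2 * c (sub k)) - (2 * (tau k ^+ 2)^-1 *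
    (f (x (sub k)) - f 0) - (curvature f u + slope f (w k)))) _; last first.
    by near: k; apply: cvgr_le g0 _ T3.
  have h : 2 * (tau k ^+ 2)^-1 * (f (x (sub k)) - f 0) <= 2 * (E * U ^+ 2 * c (sub k)).
    rewrite -mulrA ler_wpM2l // ler_pdivrMl ?exprn_gt0 //; exact: yEU.
  by move: h; lra.
have S1 : 0 < S + 1 by rewrite ltr_wpDl.
have nv : nbhs v [set z | rnorm (z - v) < T / 3 / (S + 1)].
  by apply/nearE_rnorm; exists (T / 3 / (S + 1)) => //; rewrite divr_gt0.
have [z [/= z1 z2]] := cv [set z | curvature f u + slope f z <= T / 3] _ near_w nv.
have z3 := SP (v - z); rewrite slopeB rnormB ler_norml in z3.
have z4 : S * rnorm (z - v) <= T / 3.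
  apply: (@le_trans _ _ ((S + 1) * rnorm (z - v))); first by rewrite ler_wpM2r ?rnorm_ge0 // lerDl.
  by rewrite mulrC -ler_pdivlMr // ltW.
case/andP: z3 => _ z3; move: z1 z3 z4 T0; rewrite /T; clear; lra.
Unshelve. all: by end_near. Qed.

Lemma enorm_near0 (e : R) : 0 < e -> \forall x \near (0 : 'rV[K]_n), enorm x < e.
Proof.
move=> e0; set N := (real_dim s n)%:R + 1 : R.
have N0 : 0 < N by rewrite ltr_wpDl.
apply/nearE_rnorm; exists (e / N); first by rewrite divr_gt0.
move=> x; rewrite subr0 ltr_pdivlMr // => xe.
rewrite -(@ltr_pXn2r _ 2) ?nnegrE ?enorm_ge0 ?(ltW e0) //.
apply: le_lt_trans (enorm_le x) _.
apply: (@le_lt_trans _ _ ((rnorm x * N) ^+ 2)); last first.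
  by rewrite ltr_pXn2r ?nnegrE ?mulr_ge0 ?rnorm_ge0 ?(ltW e0) ?(ltW N0).
rewrite exprMn mulrC ler_wpM2l ?exprn_ge0 ?rnorm_ge0 // expr2.
apply: (@le_trans _ _ N); first by rewrite lerDl.
by rewrite ler_pMr // /N lerDr.
Qed.

Lemma quadratic_growth_strict X f : quadratic_growth0 X f -> strict_local_minimizer0 X f.
Proof.
move=> [c [e [c0 e0 growth]]]; apply: filterS (enorm_near0 e0) => x xe Xx x0.
by apply: lt_le_trans (growth _ Xx xe); rewrite ltrDl mulr_gt0 // exprn_gt0 // enorm_gt0.
Qed.
End Conditions.

Theorem corollary5p4 (R : realType) (s : scalar_kind) (n : nat)
    (X : set 'rV[scalars R s]_n) (f : 'rV[scalars R s]_n -> R) :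
  closed X -> analytic_set [set: 'rV[scalars R s]_n] X -> X 0 ->
  C2_objective f ->
  (local_minimizer0 X f ->
    forall u, critical X f u -> admissible X u ->
      (0 <= second_order_inf f u (tangent2_alg X u))%E)
  /\
  ((forall u, critical X f u -> admissible X u) ->
    parabolic_regularity X f ->
    (forall u, tangent_cone X u -> 0 <= slope f u) ->
    ((forall u, critical X f u ->
        (0 < second_order_inf f u (tangent2 X u))%E) <->
     (forall u, critical X f u ->
        (0 < second_order_inf f u (tangent2_alg X u))%E))
    /\
    ((forall u, critical X f u ->
        (0 < second_order_inf f u (tangent2_alg X u))%E) ->
     strict_local_minimizer0 X f /\ quadratic_growth0 X f)).
Proof.
move=> _ _ X0 cf; split=> [fmin u [Tu _ su] adm|adm preg sl0].
  apply: le_ereal_inf_tmp => _ [w wE <-]; rewrite lee_fin.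
  (* Minimality supplies the sign of the slope on which the cone case relies. *)
  have sl v : tangent_cone X v -> 0 <= slope f v by exact: local_minimizer_slope.
  have [w' Tw' <-] := admissible_tangent2 X0 Tu adm sl wE.
  exact: local_minimizer_second_order Tw'.
(* The sets of values coincide, even where the sets of w do not. *)
have infE u : critical X f u ->
    second_order_inf f u (tangent2 X u) = second_order_inf f u (tangent2_alg X u).
  move=> cu; congr ereal_inf; apply/seteqP; split=> _ [w Tw <-].
    by exists w => //; exact: tangent2_sub_alg.
  have [Tu _ _] := cu.
  have [w' Tw' e] := admissible_tangent2 X0 Tu (adm _ cu) sl0 Tw.
  by exists w' => //; rewrite e.
split=> [|pos]; first by split=> H u cu; have := H u cu; rewrite infE.
have growth : quadratic_growth0 X f.
  (* Positivity over the larger set T^{2,a} passes to T^2. *)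
  apply: second_order_growth => // u w cu Tw; rewrite -lte_fin.
  apply: lt_le_trans (pos _ cu) _; apply: ereal_inf_lbound.
  by exists w => //; exact: tangent2_sub_alg.
by split=> //; exact: quadratic_growth_strict growth.
Qed.
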